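(* Let $S\subseteq\mathbb{H}^n$ be a hypersurface of class $C^1$. If $S$ is ruled, then $\varphi(S)$ is ruled for any pseudohermitian transformation $\varphi:\mathbb{H}^n\to\mathbb{H}^n$.
   Context: $\mathbb{H}^n$ is $\mathbb{R}^{2n+1}$, with points $p=(z,t)=(\bar x,\bar y,t)=(x_1,\dots,x_n,y_1,\dots,y_n,t)$, endowed with the group law $(\bar x,\bar y,t)\cdot(\bar x',\bar y',t')=(\bar x+\bar x',\bar y+\bar y',t+t'+\sum_{j=1}^n(x_j'y_j-x_jy_j'))$. The horizontal distribution $\mathcal{H}$ is given by $\mathcal{H}_p=\mathrm{span}\{Z_1|_p,\dots,Z_{2n}|_p\}$, where $Z_j=X_j=\frac{\partial}{\partial x_j}+y_j\frac{\partial}{\partial t}$ and $Z_{n+j}=Y_j=\frac{\partial}{\partial y_j}-x_j\frac{\partial}{\partial t}$ for $j=1,\dots,n$. A vector $v=\sum_{j=1}^{2n}v_jZ_j|_p\in\mathcal{H}_p$ is identified with the point $(v_1,\dots,v_{2n},0)\in\mathbb{H}^n$. Dilations: $\delta_\lambda(z,t)=(\lambda z,\lambda^2t)$. A hypersurface is an embedded $2n$-dimensional submanifold of $\mathbb{R}^{2n+1}$, at least of class $C^1$ and without boundary. Its characteristic set is $S_0=\{p\in S:\mathcal{H}_p=T_pS\}$, and $\mathcal{H}T_pS=\mathcal{H}_p\cap T_pS$. $S$ is ruled if for any $p\in S\setminus S_0$, any $v\in\mathcal{H}T_pS$ and any $s\geq0$ the following holds: if $s$ is maximal with the property that $p\cdot\delta_\tau(v)\in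 S$ for all $\tau\in[0,s]$, then $p\cdot\delta_s(v)\in S_0$. Let $\mathcal{J}:\mathbb{H}^n\to\mathbb{H}^n$ be the map $\mathcal{J}(\bar x,\bar y,t)=(-\bar y,\bar x,t)$. A pseudohermitian transformation of $\mathbb{H}^n$ is a global diffeomorphism $\varphi:\mathbb{H}^n\to\mathbb{H}^n$ that preserves the horizontal distribution and commutes with $\mathcal{J}$, that is, $d\varphi(\mathcal{H})\subseteq\mathcal{H}$ and $\varphi\circ\mathcal{J}=\mathcal{J}\circ\varphi$.
   Formalization: ''Commutes with J'' is taken as dφ∘J = J∘dφ on the horizontal distribution, not φ∘J = J∘φ as maps of points; with the latter the claim fails, e.g. n=1, φ(z,t) = (exp(i|z|²)z, t−|z|⁴/2), S = {t=0}. *)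

(* Defs.v *)
From HB Require Import structures.
From mathcomp Require Import all_boot all_order all_algebra.
From mathcomp Require Import all_classical all_reals all_analysis.

Set Implicit Arguments.
Unset Strict Implicit.
Unset Printing Implicit Defensive.

Import Order.TTheory GRing.Theory Num.Theory.
Import numFieldNormedType.Exports.

Local Open Scope classical_set_scope.
Local Open Scope ring_scope.

(* Maps of class C^k on an open set U.  For finite-dimensional V this is the
   usual notion, the directional derivatives being finite linear combinations
   of the partial ones. *)
Fixpoint Ck_on (R : realType) (V W : normedModType R) (k : nat) (U : set V)
    (f : V -> W) : Prop :=
  match k with
  | 0%N => forall x, U x -> {for x, continuous f}
  | k'.+1 => (forall x, U x -> differentiable f x) /\
             (forall v : V, Ck_on k' U ('D_v f))
  end.

Definition smooth (R : realType) (V W : normedModType R) (f : V -> W) : Prop :=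
  forall k, Ck_on k setT f.

(* A diffeomorphism without further qualification is of class C^oo. *)
Definition diffeomorphism (R : realType) (V W : normedModType R)
    (f : V -> W) : Prop :=
  smooth f /\
  exists g : W -> V, [/\ smooth g, cancel f g & cancel g f].

(* R^(2n), with points z = (x, y). *)
Notation hplane R n := ('rV[R]_n * 'rV[R]_n)%type.

(* The Heisenberg group, with points p = (z, t) = ((x, y), t).  It is also used
   for the tangent vectors, in the standard coordinates d/dx_j, d/dy_j, d/dt. *)
Notation heis R n := (hplane R n * R^o)%type.

Section Heisenberg.
Context {R : realType} {n : nat}.
Implicit Types (p q u : heis R n) (v : hplane R n) (S : set (heis R n)).

Definition hmul p q : heis R n :=
  (p.1 + q.1,
   p.2 + q.2 + \sum_(j < n) (q.1.1 0 j * p.1.2 0 j - p.1.1 0 j * q.1.2 0 j)).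

Definition dilation (l : R) p : heis R n := (l *: p.1, l ^+ 2 * p.2).

(* J (x, y, t) = (- y, x, t) *)
Definition Jmap p : heis R n := ((- p.1.2, p.1.1), p.2).

Definition Xfield (j : 'I_n) p : heis R n := ((delta_mx 0 j, 0), p.1.2 0 j).
Definition Yfield (j : 'I_n) p : heis R n := ((0, delta_mx 0 j), - p.1.1 0 j).

(* The horizontal vector at p whose coordinates in the frame
   X_1, ..., X_n, Y_1, ..., Y_n are v. *)
Definition hvec p v : heis R n :=
  \sum_(j < n) v.1 0 j *: Xfield j p + \sum_(j < n) v.2 0 j *: Yfield j p.

Definition horizontal p : set (heis R n) := range (hvec p).

(* The identification of the horizontal vector hvec p v with a point. *)
Definition hpoint v : heis R n := (v, 0).

(* J on horizontal vectors, through the identification above: the coordinates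
   of u = hvec p v in the horizontal frame are its first 2n standard
   coordinates, so v = u.1. *)
Definition Jhor p u : heis R n := hvec p (Jmap (hpoint u.1)).1.

(* S is an embedded 2n-dimensional C^1 submanifold of R^(2n+1): near each of
   its points some C^1 diffeomorphism F from an open set A onto an open set B,
   with inverse G, maps S onto the slice t = 0 of B. *)
Definition C1_hypersurface S : Prop :=
  forall p, S p ->
  exists (A B : set (heis R n)) (F G : heis R n -> heis R n),
    [/\ open A, open B & A p] /\
    [/\ Ck_on 1 A F, Ck_on 1 B G,
        forall q, A q -> B (F q) /\ G (F q) = q,
        forall q, B q -> A (G q) /\ F (G q) = q &
        forall q, A q -> (S q <-> (F q).2 = 0)].

(* T_pS: the velocities at p of the C^1 curves in S through p. *)
Definition tangent S p : set (heis R n) :=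
  [set u | exists (e : R) (c : R^o -> heis R n),
    [/\ 0 < e, Ck_on 1 (ball (0 : R^o) e) c,
        forall s, ball (0 : R^o) e s -> S (c s),
        c 0 = p & 'D_1 c 0 = u]].

Definition char_set S : set (heis R n) :=
  [set p | S p /\ horizontal p = tangent S p].

Definition htangent S p : set (heis R n) := horizontal p `&` tangent S p.

(* the half-line from p in the direction v, stopped at s, stays in S *)
Definition segment_in S p v (s : R) : Prop :=
  forall tau : R, 0 <= tau <= s -> S (hmul p (dilation tau (hpoint v))).

Definition ruled S : Prop :=
  forall p, (S `\` char_set S) p ->
  forall v, htangent S p (hvec p v) ->
  forall s : R, 0 <= s ->
    segment_in S p v s ->
    (forall s' : R, 0 <= s' -> segment_in S p v s' -> s' <= s) ->
    char_set S (hmul p (dilation s (hpoint v))).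

(* The condition "phi commutes with J" is the one on the horizontal
   distribution, d phi o J = J o d phi.  It is not the equality of the maps
   phi o Jmap and Jmap o phi of the group, which fails for left translations
   and holds for non-affine contact maps such as, for n = 1 and z = x + i y,
   (z, t) |-> (exp (i |z|^2) z, t - |z|^4 / 2). *)
Definition pseudohermitian (phi : heis R n -> heis R n) : Prop :=
  [/\ diffeomorphism phi,
      forall p u, horizontal p u -> horizontal (phi p) ('d phi p u) &
      forall p u, horizontal p u ->
        'd phi p (Jhor p u) = Jhor (phi p) ('d phi p u)].

End Heisenberg.

(* Main.v *)
(** Write phi = (zeta, h) and let A v be the derivative of zeta along the
    horizontal left-invariant field v.  The contact and CR conditions give
    <A v, A w> = lam <v, w> for a positive function lam.  Since left-invariant
    fields satisfy [v, w] = 2 sig(v, w) d/dt, differentiating this identity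
    determines the second horizontal derivatives of zeta through the first
    derivatives of lam (a Koszul formula), and differentiating once more yields
    4 lam (v v lam) <= 5 (v lam)^2, that is, lam^(-1/4) is convex along every
    horizontal line.  If it is not constant on some horizontal line, it grows
    at least linearly on a half-line, so the image of this half-line has speed
    sqrt(lam) |v| = O(s^-2) and is bounded; this is impossible because the
    inverse of phi is continuous.  Hence lam is constant, the second
    derivatives of zeta along horizontal lines vanish, and phi maps horizontal
    lines affinely to horizontal lines.  As the differential of phi also
    preserves horizontal and tangent spaces, ruledness is transported. *)
Require Import Defs.
From HB Require Import structures.
From mathcomp Require Import all_boot all_order all_algebra.
From mathcomp Require Import all_classical all_reals all_analysis.
From mathcomp Require Import ring lra.
Set Implicit Arguments.
Unset Strict Implicit.
Unset Printing Implicit Defensive.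
Import Order.TTheory GRing.Theory Num.Theory.
Import numFieldNormedType.Exports.
Local Open Scope classical_set_scope.
Local Open Scope ring_scope.

(** * Smooth maps *)

Section SmoothCalculus.
Context {R : realType}.
Implicit Types (U V W : normedModType R).

Lemma smooth_differentiable V W (f : V -> W) x : smooth f -> differentiable f x.
Proof. by move=> /(_ 1%N)[df _]; exact: df. Qed.

Lemma smooth_continuous V W (f : V -> W) : smooth f -> continuous f.
Proof. by move=> sf x; exact: differentiable_continuous (smooth_differentiable
  x sf). Qed.

Lemma smooth_derive V W (f : V -> W) v : smooth f -> smooth ('D_v f).
Proof. by move=> sf k; case: (sf k.+1) => _; exact. Qed.

Lemma smoothP V W (f : V -> W) :
  smooth f <->
  (forall x, differentiable f x) /\ (forall v, smooth ('D_v f)).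
Proof.
split=> [sf|[df sDf] [|k]].
- by split=> [x|v]; [exact: smooth_differentiable|exact: smooth_derive].
- by move=> x _; exact: differentiable_continuous.
- by split=> [x _|v]; [exact: df|exact: sDf].
Qed.

Lemma smooth_cst V W (c : W) : smooth (cst c : V -> W).
Proof.
move=> k; elim: k c => [|k IHk] c /=; first by move=> x _;
  exact: cst_continuous.
split=> [x _|v]; first exact: differentiable_cst.
suff -> : 'D_v (cst c : V -> W) = cst 0 by exact: IHk.
by apply/funext => x; rewrite derive_cst.
Qed.

(** Kept at a fixed order [k] because the induction in [smooth_bilin] adds two terms whose
    regularity is known only up to that order. *)
Lemma Ck_onTD V W k (f g : V -> W) :
  Ck_on k setT f -> Ck_on k setT g -> Ck_on k setT (f + g).
Proof.
elim: k f g => [|k IHk] f g /=.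
  by move=> cf cg x _; apply: continuousD; [exact: cf|exact: cg].
move=> [df Df] [dg Dg]; split=> [x _|v].
  by apply: differentiableD; [exact: df|exact: dg].
have -> : 'D_v (f + g) = 'D_v f + 'D_v g.
  apply/funext => x; rewrite deriveD //; apply: diff_derivable;
  by [exact: df|exact: dg].
exact: IHk.
Qed.

Lemma smoothD V W (f g : V -> W) : smooth f -> smooth g -> smooth (f + g).
Proof. by move=> sf sg k; exact: Ck_onTD. Qed.

Section Linear.
Context {V W W' : normedModType R} (L : {linear W -> W'}).
Context (cL : continuous L).

Lemma derive_linear_comp (f : V -> W) v x : differentiable f x ->
  'D_v (L \o f) x = L ('D_v f x).
Proof.
move=> df; have dL := linear_differentiable (f x) cL.
rewrite (deriveE v df) (deriveE v (differentiable_comp df dL)) (diff_comp df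
  dL).
by rewrite /= (diff_lin _ cL).
Qed.

Lemma smooth_linear_comp (f : V -> W) : smooth f -> smooth (L \o f).
Proof.
move=> sf k; elim: k f sf => [|k IHk] f sf /=.
  move=> x _; apply: continuous_comp; last exact: cL.
  exact: smooth_continuous.
split=> [x _|v].
  apply: differentiable_comp; first exact: smooth_differentiable.
  exact: linear_differentiable.
have -> : 'D_v (L \o f) = L \o 'D_v f.
  apply/funext => x; rewrite derive_linear_comp//; exact: smooth_differentiable.
by apply: IHk; exact: smooth_derive.
Qed.

End Linear.

Lemma smooth_id V : smooth (@idfun V).
Proof.
apply/smoothP; split=> [x|v]; first by case: (is_diff_id x).
suff -> : 'D_v (@idfun V) = cst v by exact: smooth_cst.
by apply/funext => x; rewrite derive_id.
Qed.

Lemma smooth_linear V W (L : {linear V -> W}) : continuous L -> smooth L.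
Proof. by move=> cL; exact: (smooth_linear_comp cL (@smooth_id V)). Qed.

Section Bilinear.
Context {U V W W' : normedModType R} (B : {bilinear V -> W -> W'}).
Context (cB : continuous (fun p : V * W => B p.1 p.2)).

Lemma differentiable_bilin_comp (f : U -> V) (g : U -> W) x :
  differentiable f x -> differentiable g x ->
  differentiable (fun y => B (f y) (g y)) x.
Proof.
move=> df dg.
apply: (@differentiable_comp _ _ _ _ (fun y => (f y, g y)) (fun p =>
  B p.1 p.2)).
  exact: differentiable_pair.
exact: differentiable_bilin.
Qed.

Lemma derive_bilin (f : U -> V) (g : U -> W) v x :
  differentiable f x -> differentiable g x ->
  'D_v (fun y => B (f y) (g y)) x = B ('D_v f x) (g x) + B (f x) ('D_v g x).
Proof.
move=> df dg; have dfg := differentiable_pair df dg.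
have dB := differentiable_bilin (f x, g x) cB.
rewrite (deriveE v df) (deriveE v dg) (deriveE v (differentiable_bilin_comp df
  dg)).
by rewrite (diff_comp dfg dB) /= (diff_bilin _ cB) (diff_pair df dg) /= addrC.
Qed.

(** The product rule yields two terms of the same shape, one with [f] and one with [g] replaced by a
    derivative, so the induction on the order runs over all pairs of smooth maps. *)
Lemma smooth_bilin (f : U -> V) (g : U -> W) :
  smooth f -> smooth g -> smooth (fun y => B (f y) (g y)).
Proof.
move=> sf sg k; elim: k f g sf sg => [|k IHk] f g sf sg /=.
  move=> x _; apply: differentiable_continuous.
  by apply: differentiable_bilin_comp; exact: smooth_differentiable.
split=> [x _|v].
  by apply: differentiable_bilin_comp; exact: smooth_differentiable.
have -> : 'D_v (fun y => B (f y) (g y)) =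
    (fun y => B ('D_v f y) (g y)) + (fun y => B (f y) ('D_v g y)).
  by apply/funext => x; rewrite derive_bilin//; exact: smooth_differentiable.
by apply: Ck_onTD; apply: IHk => //; exact: smooth_derive.
Qed.

End Bilinear.

End SmoothCalculus.

(** * Restriction to lines and symmetry of second derivatives *)

Section Lines.
Context {R : realType}.
Implicit Types (V W : normedModType R).

Lemma is_derive_line V W (f : V -> W) (x a : V) (s : R) :
  differentiable f (x + s *: a) ->
  is_derive s 1 (fun t : R => f (x + t *: a)) ('D_a f (x + s *: a)).
Proof.
move=> /diff_derivable => /(_ a) fa.
have E : (fun h : R => h^-1 *: (((fun t : R => f (x + t *: a)) \o shift s) h%:A
            - f (x + s *: a))) =
         (fun h : R => h^-1 *: ((f \o shift (x + s *: a)) (h *: a)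
            - f (x + s *: a))).
  apply/funext => h /=; congr (_ *: (f _ - _)).
  by rewrite [h%:A]mulr1 scalerDl addrCA.
by apply: DeriveDef; rewrite /derivable /derive E.
Qed.

Lemma MVT_gt0 (g dg : R -> R) (h : R) : 0 < h ->
  (forall s : R, 0 <= s -> is_derive s 1 g (dg s)) ->
  exists2 c, 0 < c < h & g h - g 0 = h * dg c.
Proof.
move=> h0 d; have [s||c ch E] := @MVT R g dg 0 h h0.
- by rewrite in_itv/= => /andP[/ltW s0 _]; exact: d.
- apply: continuous_in_subspaceT => s; rewrite inE/= in_itv/= => /andP[s0 _].
  by apply/differentiable_continuous/derivable1_diffP; case: (d s s0).
exists c; first by move: ch; rewrite in_itv.
by move: E; rewrite subr0 mulrC.
Qed.

(** Two mean value steps: along [a] for the increment of [f] by [h *: b], then along [b] for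
    ['D_a f]. *)
Lemma second_difference V (f : V -> R^o) (x a b : V) (h : R) :
  smooth f -> 0 < h ->
  exists s t, [/\ 0 < s < h, 0 < t < h &
    f (x + h *: a + h *: b) - f (x + h *: a) - (f (x + h *: b) - f x) =
    h * (h * 'D_b ('D_a f) (x + s *: a + t *: b))].
Proof.
move=> sf h0.
have [s sh Es] := @MVT_gt0
  (fun s => f (x + h *: b + s *: a) - f (x + s *: a))
  (fun s => 'D_a f (x + h *: b + s *: a) - 'D_a f (x + s *: a)) h h0
  (fun s _ => @is_deriveB _ _ _ _ _ s 1 _ _
    (is_derive_line (smooth_differentiable _ sf))
    (is_derive_line (smooth_differentiable _ sf))).
have [t th Et] := @MVT_gt0
  (fun t => 'D_a f (x + s *: a + t *: b))
  (fun t => 'D_b ('D_a f) (x + s *: a + t *: b)) h h0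
  (fun s _ => is_derive_line (smooth_differentiable _ (smooth_derive a sf))).
exists s, t; split=> //; rewrite -Et scale0r addr0.
by move: Es; rewrite !scale0r !addr0 ![x + h *: b + _]addrAC.
Qed.

(** The second difference is symmetric in [a] and [b], so the two mixed derivatives take a common
    value at points arbitrarily close to [x]; their continuity concludes. *)
Lemma derive_comm_scalar V (f : V -> R^o) (x a b : V) :
  smooth f -> 'D_b ('D_a f) x = 'D_a ('D_b f) x.
Proof.
move=> sf; apply/eqP; rewrite -subr_eq0 -normr_le0; apply/ler_addgt0Pr => e e0.
rewrite add0r.
have := smooth_continuous (smooth_derive b (smooth_derive a sf)) (x := x).
have := smooth_continuous (smooth_derive a (smooth_derive b sf)) (x := x).
move=> /cvgrPdist_lt/(_ (e / 2)) /= H1 /cvgrPdist_lt/(_ (e / 2)) /= H2.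
have e2 : 0 < e / 2 by rewrite divr_gt0.
have [r /= r0 Hr] := (nbhs_ballP _ _).1 (filterI (H1 e2) (H2 e2)).
(* With this [h] all intermediate points of the mean value steps stay in the ball of radius [r]; the
   summand 1 covers [a = b = 0]. *)
pose h := r / (`|a| + `|b| + 1).
have D0 : 0 < `|a| + `|b| + 1 by rewrite ltr_wpDl// addr_ge0.
have h0 : 0 < h by rewrite divr_gt0.
have small s t : 0 < s < h -> 0 < t < h -> ball x r (x + s *: a + t *: b).
  move=> /andP[s0 sh] /andP[t0 th].
  rewrite -ball_normE /ball_/= -addrA opprD addNKr normrN.
  apply: (le_lt_trans (ler_normD _ _)); rewrite !normrZ !gtr0_norm//.
  apply: (@le_lt_trans _ _ (h * (`|a| + `|b|))).
    by rewrite mulrDr lerD// ler_wpM2r// ltW.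
  by rewrite /h -mulrA gtr_pMr// mulrC ltr_pdivrMr// mul1r ltrDl.
have [s [t [sh th Est]]] := second_difference x a b sf h0.
have [t' [s' [th' sh' Est']]] := second_difference x b a sf h0.
have E : 'D_b ('D_a f) (x + s *: a + t *: b) = 'D_a ('D_b f) (x + t' *: b + s'
  *: a).
  apply: (mulfI (lt0r_neq0 h0)); apply: (mulfI (lt0r_neq0 h0)).
  apply: (eq_trans (esym Est)); apply: eq_trans Est'.
  by rewrite (addrAC x (h *: b) (h *: a)) !opprB addrACA [RHS]addrACA [- f _ +
    _]addrC.
have [_ /= h1] := Hr _ (small s t sh th).
have [/= h2 _] := Hr _ (small s' t' sh' th').
rewrite [x + s' *: _ + _]addrAC -E in h2.
apply: le_trans (ler_distD ('D_b ('D_a f) (x + s *: a + t *: b)) _ _) _.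
rewrite (splitr e); apply: lerD; apply: ltW; first exact: h1.
by rewrite distrC; exact: h2.
Qed.

End Lines.

(** * Horizontal frame *)

(* sig, dot, Td and hD are locked: otherwise unification unfolds the limits and
   sums behind them and diverges. *)
HB.lock Definition sig (R : realType) (n : nat) (a b : hplane R n) : R^o :=
  \sum_(j < n) (a.2 0 j * b.1 0 j - a.1 0 j * b.2 0 j).
Arguments sig {R n} a b.

HB.lock Definition dot (R : realType) (n : nat) (a b : hplane R n) : R^o :=
  \sum_(j < n) (a.1 0 j * b.1 0 j + a.2 0 j * b.2 0 j).
Arguments dot {R n} a b.

Section HorizontalPlane.
Context {R : realType} {n : nat}.
Local Notation E := (hplane R n).
Implicit Types (a b c v w : E).

Definition JJ v : E := (- v.2, v.1).

Lemma sig_is_bilinear : bilinear_for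
  (GRing.Scale.Law.clone _ _ *:%R _) (GRing.Scale.Law.clone _ _ *:%R _) (@sig R
    n).
Proof.
rewrite sig.unlock; split=> [u|u] k x y /=; rewrite scaler_sumr -big_split/=;
  by apply: eq_bigr => j _; rewrite !mxE /GRing.scale/=; ring.
Qed.

Lemma dot_is_bilinear : bilinear_for
  (GRing.Scale.Law.clone _ _ *:%R _) (GRing.Scale.Law.clone _ _ *:%R _) (@dot R
    n).
Proof.
rewrite dot.unlock; split=> [u|u] k x y /=; rewrite scaler_sumr -big_split/=;
  by apply: eq_bigr => j _; rewrite !mxE /GRing.scale/=; ring.
Qed.

HB.instance Definition _ :=
  bilinear_isBilinear.Build R E E R^o _ _ (@sig R n) sig_is_bilinear.
HB.instance Definition _ :=
  bilinear_isBilinear.Build R E E R^o _ _ (@dot R n) dot_is_bilinear.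

Lemma JJ_is_linear : linear JJ.
Proof. by move=> k x y; congr pair; rewrite /= ?opprD ?scalerN. Qed.
HB.instance Definition _ := GRing.isLinear.Build R E E _ JJ JJ_is_linear.

Lemma JJD a b : JJ (a + b) = JJ a + JJ b.
Proof. exact: linearD. Qed.

Lemma JJZ k a : JJ (k *: a) = k *: JJ a.
Proof. exact: linearZ. Qed.

Lemma coord1_continuous j : continuous (fun a : E => a.1 0 j : R^o).
Proof.
by move=> a; apply: (@continuous_comp _ _ _ fst (fun M : 'rV[R]_n => M 0 j));
  [exact: cvg_fst|exact: coord_continuous].
Qed.

Lemma coord2_continuous j : continuous (fun a : E => a.2 0 j : R^o).
Proof.
by move=> a; apply: (@continuous_comp _ _ _ snd (fun M : 'rV[R]_n => M 0 j));
  [exact: cvg_snd|exact: coord_continuous].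
Qed.

Lemma sig_continuous : continuous (fun p : E * E => sig p.1 p.2).
Proof.
have c1 j : continuous (fun p : E * E => p.1.1 0 j : R^o).
  by move=> p; apply: (@continuous_comp _ _ _ fst (fun a : E => a.1 0 j));
    [exact: cvg_fst|exact: coord1_continuous].
have c2 j : continuous (fun p : E * E => p.1.2 0 j : R^o).
  by move=> p; apply: (@continuous_comp _ _ _ fst (fun a : E => a.2 0 j));
    [exact: cvg_fst|exact: coord2_continuous].
have c3 j : continuous (fun p : E * E => p.2.1 0 j : R^o).
  by move=> p; apply: (@continuous_comp _ _ _ snd (fun a : E => a.1 0 j));
    [exact: cvg_snd|exact: coord1_continuous].
have c4 j : continuous (fun p : E * E => p.2.2 0 j : R^o).
  by move=> p; apply: (@continuous_comp _ _ _ snd (fun a : E => a.2 0 j));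
    [exact: cvg_snd|exact: coord2_continuous].
move=> p; rewrite sig.unlock; apply: cvg_big => [|j _];
  first exact: add_continuous.
by apply: cvgB; apply: cvgM; [exact: c2|exact: c3|exact: c1|exact: c4].
Qed.

(** Compatibility of metric, symplectic form and complex structure: a map that commutes with [JJ]
    and rescales [sig] also rescales [dot]. *)
Lemma dot_sig a b : dot a b = - sig a (JJ b).
Proof.
rewrite dot.unlock sig.unlock -sumrN; apply: eq_bigr => j _; rewrite /= !mxE;
  ring.
Qed.

Lemma JJ_continuous : continuous JJ.
Proof.
move=> a.
have h1 : (fun v : E => - v.2) x @[x --> a] --> - a.2.
  by apply: cvgN; exact: cvg_snd.
have h2 : (fun v : E => v.1) x @[x --> a] --> a.1 by exact: cvg_fst.
exact: cvg_pair h1 h2.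
Qed.

Lemma dot_continuous : continuous (fun p : E * E => dot p.1 p.2).
Proof.
have -> : (fun p : E * E => dot p.1 p.2) = (fun p => - sig p.1 (JJ p.2)).
  by apply/funext => p; rewrite dot_sig.
move=> p; apply: (@continuous_comp _ _ _ (fun p => sig p.1 (JJ p.2)) -%R);
  last exact: opp_continuous.
apply: (@continuous_comp _ _ _ (fun p : E * E => (p.1, JJ p.2)) (fun p =>
  sig p.1 p.2)).
  have h1 : (fun v : E * E => v.1) x @[x --> p] --> p.1 by exact: cvg_fst.
  have h2 : (fun v : E * E => JJ v.2) x @[x --> p] --> JJ p.2.
    by apply: (@continuous_comp _ _ _ snd JJ);
      [exact: cvg_snd|exact: JJ_continuous].
  exact: cvg_pair h1 h2.
exact: sig_continuous.
Qed.

Lemma JJK a : JJ (JJ a) = - a.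
Proof. by case: a. Qed.

Lemma dotC a b : dot a b = dot b a.
Proof. by rewrite dot.unlock; apply: eq_bigr => j _; congr (_ + _);
  rewrite mulrC. Qed.

Lemma sigE a b : sig a b = dot a (JJ b).
Proof. by rewrite dot_sig JJK linearNr opprK. Qed.

Lemma dotJJ a b : dot (JJ a) (JJ b) = dot a b.
Proof. by rewrite dot.unlock; apply: eq_bigr => j _; rewrite /= !mxE; ring. Qed.

Lemma dotJl a b : dot (JJ a) b = - dot a (JJ b).
Proof. by rewrite -dotJJ JJK linearNl. Qed.

Lemma dotJ a : dot a (JJ a) = 0.
Proof. by rewrite dot.unlock big1// => j _; rewrite /= !mxE; ring. Qed.

Lemma sigC a b : sig a b = - sig b a.
Proof. by rewrite !sigE -dotJl dotC. Qed.

Lemma dot_ge0 a : 0 <= dot a a.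
Proof. by rewrite dot.unlock; apply: sumr_ge0 => j _;
  rewrite addr_ge0// -expr2 sqr_ge0. Qed.

Lemma dot_eq0 a : dot a a = 0 -> a = 0.
Proof.
move=> /eqP; rewrite dot.unlock psumr_eq0; last first.
  by move=> j _; rewrite addr_ge0// -expr2 sqr_ge0.
move=> /allP a0; case: a a0 => x y /= a0; congr pair; apply/rowP => j;
  have := a0 j (mem_index_enum j); rewrite mxE -!expr2 paddr_eq0 ?sqr_ge0//.
  by rewrite sqrf_eq0 => /andP[/eqP].
by rewrite !sqrf_eq0 => /andP[_ /eqP].
Qed.

Lemma dot_gt0 a : a != 0 -> 0 < dot a a.
Proof. by move=> a0; rewrite lt_def dot_ge0 andbT;
  apply: contra a0 => /eqP/dot_eq0->. Qed.

Lemma CauchySchwarz_dot a b : dot a b ^+ 2 <= dot a a * dot b b.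
Proof.
have [->|b0] := eqVneq b 0.
  have z c : dot c 0 = 0 :> R by exact: linear0r.
  by rewrite !z expr0n mulr0.
have N0 := dot_gt0 b0.
(* The squared norm of this vector is [dot b b] times the Gram determinant of [a] and [b]. *)
have := dot_ge0 (dot b b *: a - dot a b *: b).
rewrite linearBl !linearBr !linearZl_LR !linearZr_LR/= (dotC b a)
  /GRing.scale/=.
move: (dot a b) (dot a a) (dot b b) N0 => s p q N0.
rewrite (_ : _ - _ = q * (p * q - s ^+ 2)); last by ring.
by rewrite pmulr_rge0// subr_ge0.
Qed.

Lemma dot_inj a b : (forall c, dot a c = dot b c) -> a = b.
Proof.
move=> H; apply/eqP; rewrite -subr_eq0; apply/eqP/dot_eq0.
by rewrite linearBl/= H subrr.
Qed.

Lemma dotDl a b c : dot (a + b) c = dot a c + dot b c.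
Proof. exact: linearDl. Qed.
Lemma dotDr a b c : dot a (b + c) = dot a b + dot a c.
Proof. exact: linearDr. Qed.
Lemma dotNl a b : dot (- a) b = - dot a b.
Proof. exact: linearNl. Qed.
Lemma dotNr a b : dot a (- b) = - dot a b.
Proof. exact: linearNr. Qed.
Lemma dotZl k a b : dot (k *: a) b = k * dot a b.
Proof. exact: linearZl_LR. Qed.
Lemma dotZr k a b : dot a (k *: b) = k * dot a b.
Proof. exact: linearZr_LR. Qed.
Lemma sigDr a b c : sig a (b + c) = sig a b + sig a c.
Proof. exact: linearDr. Qed.
Lemma sigZr k a b : sig a (k *: b) = k * sig a b.
Proof. exact: linearZr_LR. Qed.

End HorizontalPlane.

Section Scaling.
Context {R : realType} {W : normedModType R}.

(** Scaling under a name of its own, so that it carries a bilinear structure and the product rule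
    for bilinear maps covers a function times a vector-valued map. *)
Definition scal (k : R^o) (w : W) : W := k *: w.

Lemma scal_is_bilinear : bilinear_for
  (GRing.Scale.Law.clone _ _ *:%R _) (GRing.Scale.Law.clone _ _ *:%R _) scal.
Proof.
split=> [w k x y|x k w w']; rewrite /scal /=.
  by rewrite scalerDl scalerA.
by rewrite scalerDr !scalerA mulrC.
Qed.
HB.instance Definition _ :=
  bilinear_isBilinear.Build R R^o W W _ _ scal scal_is_bilinear.

Lemma scal_continuous : continuous (fun p : R^o * W => scal p.1 p.2).
Proof. exact: scale_continuous. Qed.

End Scaling.

Definition vert {R : realType} {n : nat} : heis R n := ((0, 0), 1).

HB.lock Definition Td (R : realType) (n : nat) (W : normedModType R)
    (F : heis R n -> W) (p : heis R n) : W := 'D_vert F p.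
Arguments Td {R n W} F p.

(** The direction moves with [p]: this is the derivative along the left-invariant horizontal field
    with constant coefficients [v], not along a constant vector. *)
HB.lock Definition hD (R : realType) (n : nat) (v : hplane R n)
    (W : normedModType R) (F : heis R n -> W) (p : heis R n) : W :=
  'D_(hvec p v) F p.
Arguments hD {R n} v {W} F p.

(** * Left-invariant derivatives and their commutators *)

Section HorizontalCalculus.
Context {R : realType} {n : nat}.
Local Notation E := (hplane R n).
Local Notation H := (heis R n).
Implicit Types (a b c v w : E) (p q u : H) (W : normedModType R).

(** In coordinates the horizontal space is the kernel of the contact form dt - sig(z, dz). *)
Lemma hvecE p v : hvec p v = (v, sig p.1 v).
Proof.
have fstE (f : 'I_n -> H) : (\sum_j f j).1 = \sum_j (f j).1.
  by apply: (big_morph fst).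
have sndE (f : 'I_n -> H) : (\sum_j f j).2 = \sum_j (f j).2.
  by apply: (big_morph snd).
have fstE' (f : 'I_n -> E) : (\sum_j f j).1 = \sum_j (f j).1.
  by apply: (big_morph fst).
have sndE' (f : 'I_n -> E) : (\sum_j f j).2 = \sum_j (f j).2.
  by apply: (big_morph snd).
rewrite /hvec; apply/eqP; rewrite xpair_eqE; apply/andP; split.
  rewrite /= !fstE /=; case: v => x y /=; rewrite xpair_eqE.
  rewrite /= !fstE' !sndE' /=.
  under [X in _ + X == _]eq_bigr do rewrite scaler0.
  under [X in X + _ == y]eq_bigr do rewrite scaler0.
  by rewrite !big1_eq addr0 add0r -!row_sum_delta !eqxx.
rewrite /= !sndE /= -big_split/= sig.unlock; apply/eqP/eq_bigr => j _.
by rewrite /GRing.scale/=; ring.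
Qed.

Lemma hvec_is_linear p : linear (hvec p).
Proof.
move=> k x y; rewrite !hvecE linearPr; congr pair.
Qed.

Lemma Td_derive W (F : H -> W) p : Td F p = 'D_vert F p.
Proof. by rewrite Td.unlock. Qed.

Lemma TdE W (F : H -> W) : Td F = 'D_vert F.
Proof. by rewrite Td.unlock. Qed.

Lemma hD_derive v W (F : H -> W) p : hD v F p = 'D_(hvec p v) F p.
Proof. by rewrite hD.unlock. Qed.

Definition flatv v : H := (v, 0).

Lemma hvec_split p v : hvec p v = flatv v + sig p.1 v *: vert.
Proof.
rewrite hvecE; congr pair; last by rewrite /= add0r [RHS]mulr1.
by rewrite /= scaler0 addr0; case: v.
Qed.

Lemma smooth_Td W (F : H -> W) : smooth F -> smooth (Td F).
Proof. by rewrite TdE; exact: smooth_derive. Qed.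

(** Reduces the variable direction to the two constant ones [flatv v] and [vert], to which
    smoothness and the symmetry of second derivatives apply. *)
Lemma hD_split v W (F : H -> W) : smooth F ->
  hD v F = 'D_(flatv v) F + (fun p => scal (sig p.1 v) (Td F p)).
Proof.
move=> sF; apply/funext => p; have dF := smooth_differentiable p sF.
by rewrite hD_derive TdE /= !fctE !deriveE// hvec_split linearD linearZ.
Qed.

Lemma hDE v W (F : H -> W) p : smooth F ->
  hD v F p = 'D_(flatv v) F p + sig p.1 v *: Td F p.
Proof. by move=> sF; rewrite hD_split. Qed.

Section SigL.
Variable v : E.
Definition sigl p : R^o := sig p.1 v.
Lemma sigl_is_linear : linear sigl.
Proof. by move=> k x y; rewrite /sigl linearPl. Qed.
HB.instance Definition _ := GRing.isLinear.Build R H R^o _ sigl sigl_is_linear.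
Lemma sigl_continuous : continuous sigl.
Proof.
move=> p.
have h1 : (fun v : H => v.1) x @[x --> p] --> p.1 by exact: cvg_fst.
have h2 : (fun=> v) x @[x --> p] --> v by exact: cvg_cst.
exact: (cvg_comp _ _ (cvg_pair h1 h2) (@sig_continuous _ _ (p.1, v))).
Qed.
Lemma derive_sigl p u : 'D_u sigl p = sig u.1 v.
Proof.
rewrite deriveE; first by rewrite (diff_lin _ sigl_continuous).
exact: linear_differentiable sigl_continuous.
Qed.
End SigL.

Lemma smooth_hD v W (F : H -> W) : smooth F -> smooth (hD v F).
Proof.
move=> sF; rewrite hD_split//; apply: smoothD; first exact: smooth_derive.
apply: (smooth_bilin (@scal_continuous _ _)); last exact: smooth_Td.
exact: smooth_linear (@sigl_continuous v).
Qed.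

(** The term in [sig u.1 b] is the derivative of the coefficient of the field; it is the source of
    all commutators below. *)
Lemma derive_hD b u p W (F : H -> W) : smooth F ->
  'D_u (hD b F) p = 'D_u ('D_(flatv b) F) p +
    (sig u.1 b *: Td F p + sig p.1 b *: 'D_u (Td F) p).
Proof.
move=> sF.
have d1 q : differentiable ('D_(flatv b) F) q by
  exact/smooth_differentiable/smooth_derive.
have d2 q : differentiable (Td F) q by exact/smooth_differentiable/smooth_Td.
have d3 q : differentiable (sigl b) q.
  exact: linear_differentiable (@sigl_continuous b).
rewrite hD_split// deriveD; first last.
- exact/diff_derivable/(differentiable_bilin_comp (@scal_continuous _ _)).
- exact/diff_derivable.
congr (_ + _); rewrite (derive_bilin (@scal_continuous _ _) _ (d3 p) (d2 p)).
by rewrite derive_sigl.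
Qed.

(** A property of the target space: proved for [R^o] by mean values and carried over to [hplane R n]
    by pairing with constant vectors. *)
Definition schwarz W := forall F : H -> W, smooth F ->
  forall u u' p, 'D_u ('D_u' F) p = 'D_u' ('D_u F) p.

(** The coefficients of the horizontal fields do not depend on t, so d/dt commutes with them. *)
Lemma hD_Td W (F : H -> W) v p : schwarz W -> smooth F ->
  Td (hD v F) p = hD v (Td F) p.
Proof.
move=> sW sF; have T := derive_hD v vert p sF.
have E0 : sig (vert (R := R) (n := n)).1 v = 0 :> R by exact: linear0l.
have E : 'D_vert ('D_(flatv v) F) p = 'D_(flatv v) (Td F) p by rewrite TdE;
  exact: sW.
rewrite [LHS]Td_derive [LHS]T (hDE _ _ (smooth_Td sF)) E0 scale0r add0r.
by rewrite E (Td_derive (Td F)).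
Qed.

Lemma hD_hD W (F : H -> W) a b p : smooth F ->
  hD a (hD b F) p =
    'D_(flatv a) ('D_(flatv b) F) p + sig p.1 a *: Td ('D_(flatv b) F) p +
    (sig a b *: Td F p +
     sig p.1 b *: ('D_(flatv a) (Td F) p + sig p.1 a *: Td (Td F) p)).
Proof.
move=> sF; rewrite hD_derive derive_hD//.
have -> : (hvec p a).1 = a by rewrite hvecE.
have := hDE a p (smooth_derive (flatv b) sF); rewrite hD_derive => ->.
by have := hDE a p (smooth_Td sF); rewrite hD_derive => ->.
Qed.

(** The algebra of [hD_comm] over an arbitrary module: the terms symmetric in the two directions
    cancel, and the antisymmetric coefficient [x] is counted twice. *)
Lemma lmod_comm_aux (W : lmodType R) (s t x y : R) (D D' A A' B B' C X : W) :
  D = D' -> A = A' -> B = B' -> y = - x ->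
  D + s *: B + (x *: X + t *: (A + s *: C)) -
  (D' + t *: A' + (y *: X + s *: (B' + t *: C))) = (2 * x) *: X.
Proof.
move=> -> -> -> ->; rewrite !scalerDr !scalerA scaleNr (mulrC t).
move: (s *: _) (t *: _) (_ *: C) => {}B {}A {}C.
rewrite mulr_natl mulr2n scalerDl; move: (x *: X) => {}X.
rewrite (AC (2*(1*(1*1))) (3*((1*2)*(4*5))))/=.
rewrite [X in _ - X](AC (2*(1*(1*1))) (3*((1*4)*(2*5))))/=.
by rewrite opprD opprK [LHS]addrACA subrr addr0.
Qed.

Lemma hD_comm W (F : H -> W) a b p : schwarz W -> smooth F ->
  hD a (hD b F) p - hD b (hD a F) p = (2 * sig a b) *: Td F p.
Proof.
move=> sW sF; rewrite !hD_hD//.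
have E0 := sW _ sF (flatv a) (flatv b) p.
have Ea : Td ('D_(flatv a) F) p = 'D_(flatv a) (Td F) p.
  by rewrite Td_derive TdE; exact: sW.
have Eb : Td ('D_(flatv b) F) p = 'D_(flatv b) (Td F) p.
  by rewrite Td_derive TdE; exact: sW.
exact: (lmod_comm_aux _ _ _ _ E0 (esym Ea) Eb (sigC b a)).
Qed.

Lemma schwarz_scalar : schwarz R^o.
Proof. by move=> F sF u u' p; exact: derive_comm_scalar. Qed.

End HorizontalCalculus.

(** * Product rules for horizontal and vertical derivatives *)

Section ProductRules.
Context {R : realType} {n : nat}.
Local Notation E := (hplane R n).
Local Notation H := (heis R n).
Implicit Types (a b c v w : E) (p q u : H) (F G : H -> E).

Lemma smooth_dot F G : smooth F -> smooth G ->
  smooth (fun p => dot (F p) (G p)).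
Proof. exact/smooth_bilin/dot_continuous. Qed.

Lemma smooth_sig F G : smooth F -> smooth G ->
  smooth (fun p => sig (F p) (G p)).
Proof. exact/smooth_bilin/sig_continuous. Qed.

Lemma derive_dot F G u p : smooth F -> smooth G ->
  'D_u (fun p => dot (F p) (G p)) p = dot ('D_u F p) (G p) + dot (F p) ('D_u G
    p).
Proof.
move=> /(@smooth_differentiable _ _ _ _ p) dF /(@smooth_differentiable _ _ _ _
  p) dG.
have T := derive_bilin (@dot_continuous R n) u dF dG.
exact: T.
Qed.

Lemma derive_sig F G u p : smooth F -> smooth G ->
  'D_u (fun p => sig (F p) (G p)) p = sig ('D_u F p) (G p) + sig (F p) ('D_u G
    p).
Proof.
move=> /(@smooth_differentiable _ _ _ _ p) dF /(@smooth_differentiable _ _ _ _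
  p) dG.
have T := derive_bilin (@sig_continuous R n) u dF dG.
exact: T.
Qed.

Lemma derive_JJ F u p : smooth F -> 'D_u (JJ \o F) p = JJ ('D_u F p).
Proof.
move=> /(@smooth_differentiable _ _ _ _ p) dF.
have T := derive_linear_comp (@JJ_continuous R n) u dF.
exact: T.
Qed.

Lemma smooth_JJ F : smooth F -> smooth (JJ \o F).
Proof. exact/smooth_linear_comp/JJ_continuous. Qed.

Lemma hD_dot v F G p : smooth F -> smooth G ->
  hD v (fun p => dot (F p) (G p)) p = dot (hD v F p) (G p) + dot (F p) (hD v G
    p).
Proof. by move=> sF sG; rewrite !hD_derive; exact: derive_dot. Qed.

Lemma hD_sig v F G p : smooth F -> smooth G ->
  hD v (fun p => sig (F p) (G p)) p = sig (hD v F p) (G p) + sig (F p) (hD v G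
    p).
Proof. by move=> sF sG; rewrite !hD_derive; exact: derive_sig. Qed.

Lemma Td_sig F G p : smooth F -> smooth G ->
  Td (fun p => sig (F p) (G p)) p = sig (Td F p) (G p) + sig (F p) (Td G p).
Proof. by move=> sF sG; rewrite !Td_derive; exact: derive_sig. Qed.

Lemma hD_JJ v F p : smooth F -> hD v (JJ \o F) p = JJ (hD v F p).
Proof. by move=> sF; rewrite !hD_derive; exact: derive_JJ. Qed.

Lemma Td_JJ F p : smooth F -> Td (JJ \o F) p = JJ (Td F p).
Proof. by move=> sF; rewrite !Td_derive; exact: derive_JJ. Qed.

Lemma hDD v (W : normedModType R) (F G : H -> W) p : smooth F -> smooth G ->
  hD v (fun q => F q + G q) p = hD v F p + hD v G p.
Proof.
move=> /(@smooth_differentiable _ _ _ _ p)/diff_derivable dF.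
move=> /(@smooth_differentiable _ _ _ _ p)/diff_derivable dG.
have T := deriveD (dF (hvec p v)) (dG (hvec p v)).
by rewrite !hD_derive; exact: T.
Qed.

Lemma hDZ v (W : normedModType R) k (F : H -> W) p : smooth F ->
  hD v (fun q => k *: F q) p = k *: hD v F p.
Proof.
move=> /(@smooth_differentiable _ _ _ _ p)/diff_derivable dF.
have T := deriveZ k (dF (hvec p v)).
by rewrite !hD_derive; exact: T.
Qed.

Lemma hD_linear v w k (W : normedModType R) (F : H -> W) p : smooth F ->
  hD (k *: v + w) F p = k *: hD v F p + hD w F p.
Proof.
move=> /(@smooth_differentiable _ _ _ _ p) dF.
have dE x : hD x F p = 'd F p (hvec p x) by rewrite hD_derive; exact: deriveE.
rewrite !dE hvec_is_linear.
have L' := linearP ('d F p) k (hvec p v) (hvec p w); exact: L'.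
Qed.

Lemma hD0 (W : normedModType R) (F : H -> W) p : smooth F -> hD 0 F p = 0.
Proof.
move=> sF; have T := hD_linear 0 0 1 p sF.
rewrite !scale1r addr0 in T.
by apply: (addrI (hD 0 F p)); rewrite -T addr0.
Qed.

Lemma smooth_dot_cst F c : smooth F -> smooth (fun p => dot (F p) c).
Proof. by move=> sF; exact: smooth_dot sF (@smooth_cst R H E c). Qed.

Lemma hD_dot_cst v F c p : smooth F ->
  hD v (fun q => dot (F q) c) p = dot (hD v F p) c.
Proof.
move=> sF; have T := hD_dot v p sF (@smooth_cst R H E c); rewrite [LHS]T.
have -> : hD v (cst c : H -> E) p = 0 by rewrite hD_derive derive_cst.
by rewrite (dotC (F p)) -(scale0r 0) dotZl mul0r addr0.
Qed.

Lemma schwarz_hplane : schwarz (n := n) (hplane R n).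
Proof.
move=> F sF u u' p; apply: dot_inj => c.
have sc : smooth (cst c : H -> E) by exact: smooth_cst.
have D (G : H -> E) (z q : H) : smooth G ->
    'D_z (fun q => dot (G q) c) q = dot ('D_z G q) c.
  move=> sG; have T := derive_dot z q sG sc; rewrite T derive_cst.
  rewrite -[RHS]addr0; congr (_ + _).
  by rewrite dot.unlock big1// => j _; rewrite !mxE !mulr0 addr0.
have D2 (z z' : H) :
    'D_z ('D_z' (fun q => dot (F q) c)) p = dot ('D_z ('D_z' F) p) c.
  have <- := D _ z p (smooth_derive z' sF).
  have -> : 'D_z' (fun q => dot (F q) c) = (fun q => dot ('D_z' F q) c).
    by apply/funext => q; exact: D.
  by [].
have T := derive_comm_scalar p u' u (smooth_dot sF sc).
by rewrite !{}D2 in T.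
Qed.

End ProductRules.

(** * Contact CR maps *)

Section ContactCR.
Context {R : realType} {n : nat}.
Local Notation E := (hplane R n).
Local Notation H := (heis R n).
Context (zeta : H -> E) (h : H -> R^o) (szeta : smooth zeta) (sh : smooth h).
(** [hJ] is the CR condition. [hC] is the contact condition: by [hvecE], it says that images of
    horizontal vectors are horizontal. *)
Context (hJ : forall v p, hD (JJ v) zeta p = JJ (hD v zeta p)).
Context (hC : forall v p, hD v h p = sig (zeta p) (hD v zeta p)).
Implicit Types (a b c v w : E) (p q u : H).

Local Notation A v := (hD v zeta).
Local Notation tau := (Td zeta).

(* The pullback of the contact form is lam times the contact form. *)
Definition lam p : R^o := Td h p + sig (tau p) (zeta p).

Lemma smooth_A v : smooth (A v).
Proof. exact: smooth_hD. Qed.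

Lemma smooth_tau : smooth tau.
Proof. exact: smooth_Td. Qed.

Lemma smooth_lam : smooth lam.
Proof.
have s1 := smooth_Td sh; have s2 := smooth_sig smooth_tau szeta.
exact: (smoothD s1 s2).
Qed.

Lemma A_comm v w p : hD v (A w) p = hD w (A v) p + (2 * sig v w) *: tau p.
Proof.
have T := hD_comm v w p (@schwarz_hplane R n) szeta.
by rewrite -T addrC subrK.
Qed.

(** Apply the commutator of [v] and [w] to [h] and expand by [hC]. The second derivatives of [zeta]
    reduce to their own commutator, a multiple of [tau], which completes [Td h] to [lam]. *)
Lemma sig_A v w p : sig (A v p) (A w p) = sig v w * lam p.
Proof.
have T : hD v (hD w h) p - hD w (hD v h) p = 2 * sig v w * Td h p.
  exact: (hD_comm v w p (@schwarz_scalar R n) sh).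
have D x y : hD x (hD y h) p = sig (A x p) (A y p) + sig (zeta p) (hD x (A y)
  p).
  have -> : hD y h = (fun p => sig (zeta p) (A y p)) by apply/funext => q;
    exact: hC.
  by have T' := hD_sig x p szeta (smooth_A y); exact: T'.
move: T; rewrite !D (A_comm v w) (sigC (A w p)) sigDr sigZr /lam (sigC _ (zeta
  p)).
move: (sig (A v p) (A w p)) (sig _ (hD w (A v) p)) (sig _ (tau p)) (sig v w)
  (Td h p).
by rewrite /= => a b c d e; lra.
Qed.

Lemma dot_A v w p : dot (A v p) (A w p) = dot v w * lam p.
Proof. by rewrite dot_sig -hJ sig_A dot_sig mulNr. Qed.

(** Commuting [Td] with [hD v] turns the derivative of [Td h] into the vertical derivative of
    [sig (zeta q) (A v q)]; the terms with [zeta] undifferentiated cancel and [sig (tau p) (A v p)]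
    occurs twice. *)
Lemma hD_lam v p : hD v lam p = 2 * sig (tau p) (A v p).
Proof.
have s1 := smooth_Td sh; have s2 := smooth_sig smooth_tau szeta.
have T1 := hDD v p s1 s2; rewrite [LHS]T1.
have T2 := hD_sig v p smooth_tau szeta; rewrite [X in _ + X]T2.
have T3 := hD_Td v p (@schwarz_scalar R n) sh; rewrite -T3.
have -> : hD v h = (fun p => sig (zeta p) (A v p)) by apply/funext => q;
  exact: hC.
rewrite Td_sig//; last exact: smooth_A.
have T5 := hD_Td v p (@schwarz_hplane R n) szeta.
rewrite T5 (sigC (zeta p)).
by move: (sig _ (A v p)) (sig _ (zeta p)) => /= a b; lra.
Qed.

Lemma hD_lamJ v p : hD v lam p = 2 * dot (tau p) (A (JJ v) p).
Proof. by rewrite hD_lam hJ -sigE. Qed.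

(** Gives the components of [tau] in the frame [A] as derivatives of [lam]. *)
Lemma dot_tau v p : 2 * dot (tau p) (A v p) = - hD (JJ v) lam p.
Proof. by rewrite hD_lam hJ dot_sig mulrN. Qed.

(* Koszul formula: the torsion of the frame A is the term in sig. *)
Lemma dot_hDA v c p : 2 * dot (hD v (A v) p) (A c p) =
  2 * hD v lam p * dot v c - hD c lam p * dot v v
  - 4 * sig v c * dot (tau p) (A v p).
Proof.
have dA x a b : hD x (fun q => dot (A a q) (A b q)) p = dot a b * hD x lam p.
  have -> : (fun q => dot (A a q) (A b q)) = (fun q => dot a b *: lam q).
    by apply/funext => q; exact: dot_A.
  by have T := hDZ x (dot a b) p smooth_lam; exact: T.
(* Differentiate <A v, A c> along [v] and <A v, A v> along [c]; exchanging the order of [v] and [c]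
   on [zeta] produces the torsion term. *)
have T1 := hD_dot v p (smooth_A v) (smooth_A c); rewrite dA in T1.
have T2 := hD_dot c p (smooth_A v) (smooth_A v); rewrite dA in T2.
move: T1 T2; rewrite (A_comm v c) dotDr dotZr (dotC (A v p) (hD c _ p)).
rewrite (dotC (A v p) (tau p)).
move: (dot v c) (dot v v) (hD v lam p) (hD c lam p) (sig v c).
move: (dot (tau p) _) (dot (hD v (A v) p) _) (dot (hD c (A v) p) _).
move=> x1 x2 x3 x4 x5 x6 x7 x8; nra.
Qed.

Lemma A_JJ v : A (JJ v) = JJ \o A v.
Proof. by apply/funext => q; exact: hJ. Qed.

(** * Second derivative of the conformal factor along a horizontal field *)

Section Hessian.
Context (v : E).
Local Notation N := (dot v v).
Local Notation acc := (hD v (A v)).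

Lemma smooth_acc : smooth acc.
Proof. exact/smooth_hD/smooth_A. Qed.

Lemma sigJ : sig v (JJ v) = - N.
Proof. by rewrite sigE JJK dotNr. Qed.

Lemma hD_A_JJ w : hD w (A (JJ v)) = JJ \o hD w (A v).
Proof. by apply/funext => q; rewrite A_JJ hD_JJ//; exact: smooth_A. Qed.

(** Exchange [JJ v] and [v] by the commutator, then move [JJ] outside by the CR condition. *)
Lemma hDJ_A : hD (JJ v) (A v) = (fun q => JJ (acc q) + (2 * N) *: tau q).
Proof.
apply/funext => q; rewrite (A_comm (JJ v) v) sigC sigJ opprK.
by rewrite hD_A_JJ.
Qed.

Lemma hD_tau w : hD w tau = Td (A w).
Proof. by apply/funext => q; rewrite (hD_Td _ _ (@schwarz_hplane R n) szeta).
  Qed.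

(** One [2 * N] comes from differentiating the [tau] term of [hDJ_A] along [v], the other from the
    commutator of [v] and [JJ v] on [A v]. *)
Lemma JJ_hD_acc p :
  JJ (hD v acc p) = hD (JJ v) acc p - (4 * N) *: Td (A v) p.
Proof.
have T := hD_comm v (JJ v) p (@schwarz_hplane R n) (smooth_A v).
have s1 := smooth_JJ smooth_acc.
have s2 : smooth (fun q => (2 * N) *: tau q).
  have T' := smooth_bilin (@scal_continuous R E) (@smooth_cst R H R^o (2 * N))
    smooth_tau.
  exact: T'.
have E1 : hD v (hD (JJ v) (A v)) p = JJ (hD v acc p) + (2 * N) *: Td (A v) p.
  rewrite hDJ_A (hDD v p s1 s2) hDZ; last exact: smooth_tau.
  by rewrite hD_JJ ?hD_tau//; exact: smooth_acc.
move: T; rewrite E1 sigJ => /eqP; rewrite subr_eq => /eqP T.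
apply: (addIr ((2 * N) *: Td (A v) p));
  rewrite T -addrA -scaleNr -scalerDl [LHS]addrC.
by congr (_ + _ *: _); lra.
Qed.

Let m p := dot (Td (A v) p) (A (JJ v) p).
Let j p := dot (acc p) (JJ (tau p)).

(* The five equations below come from the commutator of v and JJ v applied to
   A v, and from the derivatives of <acc, A v>, <acc, A (JJ v)>,
   <tau, A (JJ v)> and <tau, A v>.  Together they are a linear system whose
   solution for the second derivative of lam along v is hessian_lam. *)
Lemma hessian_eq1 p :
  dot (hD v acc p) (A v p) - dot (hD (JJ v) acc p) (A (JJ v) p) = - (4 * N) * m
    p.
Proof.
rewrite -(dotJJ (hD v acc p)) JJ_hD_acc A_JJ /= dotDl dotNl dotZl /m A_JJ /=.
by rewrite mulNr addrAC subrr add0r.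
Qed.

Lemma hessian_eq2 p :
  2 * (dot (hD v acc p) (A v p) + dot (acc p) (acc p)) = N * hD v (hD v lam) p.
Proof.
have E1 : (fun q => dot (acc q) (A v q)) = (fun q => (N / 2) *: hD v lam q).
  apply/funext => q; have := dot_hDA v v q; rewrite sigE dotJ.
  rewrite /GRing.scale/=; move: (dot _ _) (dot _ _) (hD v lam q) => x y z.
  by move=> T; nra.
have T := hD_dot v p smooth_acc (smooth_A v).
rewrite E1 hDZ in T; last exact/smooth_hD/smooth_lam.
rewrite -T /GRing.scale/=; lra.
Qed.

Lemma hessian_eq3 p :
  2 * (dot (hD (JJ v) acc p) (A (JJ v) p) - dot (acc p) (acc p) + 2 * N * j p) =
  - 3 * N * hD (JJ v) (hD (JJ v) lam) p.
Proof.
(* Of the factor 3, one unit is the gradient term of the Koszul formula and two come from its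
   torsion term through [dot_tau]. *)
have E1 : (fun q => dot (acc q) (A (JJ v) q)) =
          (fun q => (- 3 / 2 * N) *: hD (JJ v) lam q).
  apply/funext => q; have := dot_hDA v (JJ v) q; rewrite sigJ dotJ.
  have := dot_tau v q; rewrite /GRing.scale/=.
  move: (dot (tau q) _) (dot (acc q) _) (hD v lam q) (hD (JJ v) lam q) N =>
    x y z t u.
  by move=> T1 T2; nra.
have T := hD_dot (JJ v) p smooth_acc (smooth_A (JJ v)).
rewrite E1 hDZ in T; last exact/smooth_hD/smooth_lam.
have E2 : hD (JJ v) (A (JJ v)) p = - acc p + (2 * N) *: JJ (tau p).
  by rewrite hD_A_JJ /= hDJ_A JJD JJZ JJK.
move: T; rewrite E2 dotDr dotNr dotZr /GRing.scale/= -/(j p).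
move: (dot _ _) (dot _ _) (dot _ _) (j p) (hD _ _ _) => x y z t u; lra.
Qed.

Lemma hessian_eq4 p : hD v (hD v lam) p = 2 * (m p - j p).
Proof.
have E1 : hD v lam = (fun q => 2 *: (dot (tau q) (A (JJ v) q) : R^o)).
  by apply/funext => q; exact: hD_lamJ.
rewrite {1}E1 hDZ; last exact: smooth_dot smooth_tau (smooth_A _).
rewrite (hD_dot v p smooth_tau (smooth_A _)) hD_tau -/(m p) hD_A_JJ /=.
by rewrite /j -(dotJJ (acc p)) JJK dotNr opprK dotC.
Qed.

Lemma hessian_eq5 p :
  - hD (JJ v) (hD (JJ v) lam) p = 2 * (- m p - j p + 2 * N * dot (tau p) (tau
    p)).
Proof.
have E1 : hD (JJ v) lam = (fun q => - 2 *: (dot (tau q) (A v q) : R^o)).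
  apply/funext => q; have := dot_tau v q; rewrite /GRing.scale/=.
  by move: (dot _ _) (hD _ lam q) => x y T; lra.
rewrite {1}E1 hDZ; last exact: smooth_dot smooth_tau (smooth_A _).
rewrite (hD_dot (JJ v) p smooth_tau (smooth_A _)) hD_tau hDJ_A dotDr dotZr.
have -> : dot (Td (A (JJ v)) p) (A v p) = - m p.
  by rewrite A_JJ Td_JJ; [rewrite dotJl /m A_JJ|exact: smooth_A].
have -> : dot (tau p) (JJ (acc p)) = - j p by rewrite /j dotC dotJl.
rewrite /GRing.scale/=; move: (m p) (j p) (dot _ _) N => x y z t; lra.
Qed.

(** Subtracting [hessian_eq3] from [hessian_eq2] leaves the difference evaluated by [hessian_eq1];
    [hessian_eq4] and [hessian_eq5] then eliminate [m] and the second derivative along [JJ v]. *)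
Lemma hessian_lam p :
  2 * N * hD v (hD v lam) p =
  3 * N ^+ 2 * dot (tau p) (tau p) + dot (acc p) (acc p)
  - 6 * N * dot (acc p) (JJ (tau p)).
Proof.
have := hessian_eq1 p; have := hessian_eq2 p; have := hessian_eq3 p.
have := hessian_eq4 p; have := hessian_eq5 p; rewrite -/(j p).
move: (hD v (hD v lam) p) (hD (JJ v) (hD (JJ v) lam) p).
move: (dot (acc p) (acc p)) (dot (tau p) (tau p)).
move: (dot (hD v acc p) _) (dot (hD (JJ v) acc p) _) (m p) (j p) N.
move=> a b c d e f g x y; nra.
Qed.

End Hessian.

Lemma A_linear p : linear (fun v => A v p).
Proof. by move=> k v w; rewrite hD_linear. Qed.

(** By [dot_A] the linear map [v] to [A v p] is injective where [lam] is nonzero, hence onto by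
    equality of dimensions. *)
Lemma A_surj p e : lam p != 0 -> exists c, e = A c p.
Proof.
move=> lam0.
pose f : {linear E -> E} := HB.pack (fun v => A v p)
  (GRing.isLinear.Build R E E _ (fun v => A v p) (A_linear p)).
have k0 : lker (linfun f) == 0%VS.
  apply/lker0P => v w; rewrite !lfunE /= => vw.
  apply/eqP; rewrite -subr_eq0; apply/eqP/dot_eq0/eqP.
  have : dot (A (v - w) p) (A (v - w) p) = 0.
    rewrite -[v - w]addrC -scaleN1r A_linear vw scaleN1r addNr.
    by rewrite -[0](scale0r 0) dotZl mul0r.
  by rewrite dot_A => /eqP; rewrite mulf_eq0 (negbTE lam0) orbF.
have : e \in limg (linfun f) by rewrite lker0_limgf// memvf.
by move=> /memv_imgP[c _ ->]; exists c; rewrite lfunE.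
Qed.

(** In the frame [A], [tau] and the acceleration become vectors [k] and [c], and [c] is determined
    by [k] and [v]. The gap between the two sides is 4 lam^2 (|v|^2 |k|^2 - <k, J v>^2 + 2 <k,
    v>^2), nonnegative by Cauchy-Schwarz. *)
Lemma hessian_lam_le v p : v != 0 -> lam p != 0 ->
  4 * (lam p * hD v (hD v lam) p) <= 5 * hD v lam p ^+ 2.
Proof.
move=> v0 lam0; have N0 := dot_gt0 v0.
have [k tauE] := A_surj (tau p) lam0.
have [c accE] := A_surj (hD v (A v) p) lam0.
have lamE d : hD d lam p = 2 * lam p * dot k (JJ d).
  by rewrite hD_lamJ tauE dot_A; ring.
(* The Koszul formula divided by [2 * lam p]. *)
have cE d : dot c d = 2 * dot k (JJ v) * dot v d - dot v v * dot k (JJ d)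
    - 2 * dot v (JJ d) * dot k v.
  have := dot_hDA v d p; rewrite accE tauE !dot_A !lamE sigE => T.
  by apply: (mulfI lam0); move: T; lra.
have cv : dot c v = dot v v * dot k (JJ v) by rewrite cE dotJ; ring.
have cJv : dot c (JJ v) = 3 * dot v v * dot k v.
  by rewrite cE dotJ JJK !dotNr; ring.
have vJk : dot v (JJ k) = - dot k (JJ v) by rewrite dotC dotJl.
have cJk : dot c (JJ k) = - 2 * dot k (JJ v) ^+ 2 + dot v v * dot k k + 2 * dot
  k v ^+ 2.
  by rewrite cE JJK !dotNr vJk (dotC v k); ring.
have kJc : dot k (JJ c) = - dot c (JJ k) by rewrite dotC dotJl.
have vJc : dot v (JJ c) = - dot c (JJ v) by rewrite dotC dotJl.
have cc : dot c c = dot v v ^+ 2 * dot k k + 8 * dot v v * dot k v ^+ 2.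
  by rewrite cE kJc vJc (dotC v c) cv cJv cJk; ring.
have := hessian_lam v p; rewrite accE tauE -hJ !dot_A lamE cc cJk => T.
have CS := CauchySchwarz_dot k (JJ v); rewrite dotJJ in CS.
have -> : hD v (hD v lam) p = lam p *
    (- (dot v v * dot k k) - 2 * dot k v ^+ 2 + 6 * dot k (JJ v) ^+ 2).
  have NN : 2 * dot v v != 0 by rewrite mulf_neq0 ?pnatr_eq0 ?gt_eqF.
  by apply: (mulfI NN); rewrite T; ring.
rewrite -subr_ge0; move: (dot k v) (dot k (JJ v)) (dot v v) (dot k k) (lam p)
  CS.
move=> x y N K l CS.
rewrite [leRHS](_ : _ = 4 * l ^+ 2 * (N * K - y ^+ 2 + 2 * x ^+ 2));
  last by ring.
apply: mulr_ge0; first by rewrite mulr_ge0 ?sqr_ge0.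
by apply: addr_ge0; [rewrite subr_ge0 mulrC|rewrite mulr_ge0 ?sqr_ge0].
Qed.

(** Every term of the Koszul formula then vanishes; testing it against the acceleration itself,
    which lies in the range of [A], gives zero norm. *)
Lemma acc_eq0 v p : lam p != 0 -> (forall d, hD d lam p = 0) -> hD v (A v) p =
  0.
Proof.
move=> lam0 lam'0; have [c accE] := A_surj (hD v (A v) p) lam0.
have t0 : dot (tau p) (A v p) = 0.
  by have := dot_tau v p; rewrite lam'0 => T; lra.
have := dot_hDA v c p; rewrite !lam'0 t0 -accE => T.
by apply: dot_eq0; lra.
Qed.

End ContactCR.

(** * Horizontal lines and completeness *)

Section RealODE.
Context {R : realType}.
Implicit Types (f g : R -> R).

Lemma is_derive_mul f g (s df dg : R) :
  is_derive s 1 f df -> is_derive s 1 g dg ->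
  is_derive s 1 (fun x => f x * g x) (f s * dg + g s * df).
Proof. by move=> hf hg; exact: is_deriveM. Qed.

Lemma nondecreasing_gt0 f (f1 : R -> R) :
  (forall s : R, 0 <= s -> is_derive s 1 f (f1 s)) ->
  (forall s, 0 <= s -> 0 <= f1 s) ->
  forall s, 0 <= s -> f 0 <= f s.
Proof.
move=> df f1_ge0 s; rewrite le_eqVlt => /predU1P[<-//|s0].
have [c /andP[c0 _] E] := MVT_gt0 s0 df.
by rewrite -subr_ge0 E mulr_ge0// ?f1_ge0// ltW.
Qed.

(* The hypothesis on l says that l^(-1/4) is convex. *)
Lemma quartic_decay (l l1 l2 : R -> R) :
  (forall s : R, is_derive s 1 l (l1 s)) ->
  (forall s : R, is_derive s 1 l1 (l2 s)) ->
  (forall s, 0 < l s) -> (forall s, 4 * (l s * l2 s) <= 5 * l1 s ^+ 2) ->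
  l1 0 < 0 ->
  exists a b, [/\ 0 < a, 0 < b &
    forall s, 0 <= s -> l s * (a + b * s) ^+ 4 <= 1].
Proof.
move=> dl dl1 l0 H l10.
have lN0 s : l s != 0 by rewrite gt_eqF.
(* [f] is l^(-1/4) and [e] the logarithmic derivative of [l]; [f1] and [f2] below are the first two
   derivatives of [f]. *)
pose f s := expR (- 4^-1 * ln (l s)).
pose e s := (l s)^-1 * l1 s.
have dln (s : R) : is_derive s 1 (fun s => ln (l s)) (e s).
  by have T := is_derive1_comp (is_derive1_ln (l0 s)) (dl s); exact: T.
have df (s : R) : is_derive s 1 f (f s * (- 4^-1 * e s)).
  have T := is_deriveZ (- 4^-1) (dln s).
  by have T' := is_derive1_comp (is_derive_expR _) T; exact: T'.
have de (s : R) : is_derive s 1 e ((l s)^-1 * l2 s - (l s)^-2 * l1 s ^+ 2).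
  have T := is_derive_mul (is_deriveV (lN0 s) (dl s)) (dl1 s).
  by apply: (is_derive_eq T); rewrite /GRing.scale/=; ring.
have f0 s : 0 < f s by exact: expR_gt0.
pose f1 s := f s * (- 4^-1 * e s).
pose f2 s := f s * (16^-1 * (l s)^-2 * (5 * l1 s ^+ 2 - 4 * (l s * l2 s))).
have df1 (s : R) : is_derive s 1 f1 (f2 s).
  have T := is_derive_mul (df s) (is_deriveZ (- 4^-1) (de s)).
  apply: (is_derive_eq T); rewrite /f2 /e /= /GRing.scale/= /GRing.scale/=;
    field.
  by rewrite lN0.
have f2_ge0 s : 0 <= f2 s.
  by rewrite !mulr_ge0 ?subr_ge0// ?(ltW (f0 s))// invr_ge0 ?exprn_ge0// ltW.
have f10 : 0 < f1 0.
  by rewrite /f1 /e pmulr_rgt0// nmulr_rgt0 ?oppr_lt0// pmulr_rlt0// invr_gt0.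
have f1_ge s : 0 <= s -> f1 0 <= f1 s.
  by move=> s0; apply: (nondecreasing_gt0 (fun s _ => df1 s)).
have dg (s : R) : is_derive s 1 (fun s => f s - f1 0 * s) (f1 s - f1 0).
  have T := is_deriveB (df s) (is_deriveZ (f1 0) (is_derive_id s 1)).
  by apply: (is_derive_eq T); rewrite /f1 [_%:A]mulr1.
exists (f 0), (f1 0); split=> // s s0.
(* A convex function lies above its tangent at 0, whose slope is positive because [l1 0 < 0]. *)
have fs : f 0 + f1 0 * s <= f s.
  have dg_ge0 t : 0 <= t -> 0 <= f1 t - f1 0 by move=> /f1_ge; rewrite subr_ge0.
  have := nondecreasing_gt0 (fun s _ => dg s) dg_ge0 s0.
  by rewrite mulr0 subr0 lerBrDr.
have lf : l s * f s ^+ 4 = 1.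
  rewrite /f -expRM_natl mulrA mulrN mulfV ?pnatr_eq0// mulN1r expRN lnK
    ?posrE//.
  by rewrite mulfV.
rewrite -lf ler_pM2l// lerXn2r// nnegrE ?ltW//.
by rewrite ltr_pwDl// mulr_ge0// ltW.
Qed.

(** The majorant C / (a + b s)^2 of the speed has the bounded antiderivative [- w], so [y - w] and
    [- y - w] are both nondecreasing. *)
Lemma bounded_of_quadratic_decay (y y1 : R -> R) (C a b : R) :
  (forall s : R, is_derive s 1 y (y1 s)) -> 0 <= C -> 0 < a -> 0 < b ->
  (forall s, 0 <= s -> `|y1 s| * (a + b * s) ^+ 2 <= C) ->
  exists M, forall s, 0 <= s -> `|y s| <= M.
Proof.
move=> dy C0 a0 b0 H.
have ab s : 0 <= s -> 0 < a + b * s.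
  by move=> s0; rewrite ltr_pwDl// mulr_ge0// ltW.
pose w s := C / b * (a + b * s)^-1.
have dw (s : R) : 0 <= s -> is_derive s 1 w (- (C / (a + b * s) ^+ 2)).
  move=> s0; have abs0 : a + b * s != 0 by rewrite gt_eqF// ab.
  have T1 := is_deriveD (is_derive_cst a s 1) (is_deriveZ b (is_derive_id s 1)).
  have T := is_deriveZ (C / b) (@is_deriveV _ (fun s =>
    a + b * s) s _ _ abs0 T1).
  apply: (is_derive_eq T); rewrite [_%:A]mulr1 /GRing.scale/= add0r.
  by field; rewrite abs0 gt_eqF.
have y1_le s : 0 <= s -> `|y1 s| <= C / (a + b * s) ^+ 2.
  by move=> s0; rewrite ler_pdivlMr ?H// exprn_gt0// ab.
have Hw s : 0 <= s -> 0 <= w s <= C / b / a.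
  move=> s0; have Cb : 0 <= C / b by rewrite divr_ge0// ltW.
  have p0 := ab s s0; apply/andP; split;
    first by rewrite mulr_ge0// invr_ge0 ltW.
  apply: ler_wpM2l => //; rewrite lef_pV2 ?posrE// lerDl mulr_ge0//.
  exact: ltW.
exists (`|y 0| + C / b / a) => s s0.
have w0 : w 0 = C / b / a by rewrite /w mulr0 addr0.
have U := @nondecreasing_gt0 (fun s => - y s - w s) (fun s =>
  - y1 s - - (C / (a + b * s) ^+ 2))
  (fun s s0 => is_deriveB (is_deriveN (dy s)) (dw s s0)).
have D := @nondecreasing_gt0 (fun s => y s - w s) (fun s =>
  y1 s - - (C / (a + b * s) ^+ 2))
  (fun s s0 => is_deriveB (dy s) (dw s s0)).
have {}U : - y 0 - w 0 <= - y s - w s.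
  apply: U => // t t0; have := y1_le t t0; rewrite ler_norml => /andP[_ ?].
  by rewrite opprK addrC subr_ge0.
have {}D : y 0 - w 0 <= y s - w s.
  apply: D => // t t0; have := y1_le t t0; rewrite ler_norml => /andP[? _].
  by rewrite opprK -lerBlDr sub0r.
have /andP[ws0 _] := Hw s s0.
rewrite w0 in U D.
have y0l := ler_norm (y 0); have y0r := ler_norm (- y 0); rewrite normrN in y0r.
rewrite ler_norml; apply/andP; split; lra.
Qed.
End RealODE.

(** * Horizontal lines and half-lines with bounded image *)

Section HorizontalLines.
Context {R : realType} {n : nat}.
Local Notation E := (hplane R n).
Local Notation H := (heis R n).
Implicit Types (a b c v w : E) (p q u : H).

Lemma hvec1 p v : (hvec p v).1 = v.
Proof. by rewrite hvecE. Qed.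

Lemma hvec0 p : hvec p 0 = 0 :> H.
Proof.
have s0 : sig p.1 0 = 0 :> R by exact: linear0r.
by rewrite hvecE s0.
Qed.

Lemma hvec_inj p : injective (hvec p).
Proof. by move=> v w /(congr1 fst); rewrite !hvec1. Qed.

Lemma sig_self v : sig v v = 0 :> R.
Proof. by rewrite sigE dotJ. Qed.

(** Since [sig v v = 0], the field is constant along its own line: integral curves are straight. *)
Lemma hvec_line p v (s : R) : hvec (p + s *: hvec p v) v = hvec p v.
Proof.
rewrite !hvecE /=; congr pair; have := sig_is_bilinear (R := R) (n := n).
move=> [/(_ v s v p.1)/= T _]; rewrite addrC T sig_self.
by rewrite scaler0 add0r.
Qed.

(** On points with vanishing t-coordinate dilations are linear, so the curves in [ruled] are affine
    half-lines. *)
Lemma hmul_dilation p v (s : R) :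
  hmul p (dilation s (hpoint v)) = p + s *: hvec p v.
Proof.
rewrite hvecE; apply/eqP; rewrite /hmul xpair_eqE/=; apply/andP; split=> //.
rewrite mulr0 addr0 sig.unlock; apply/eqP; congr (_ + _).
by rewrite scaler_sumr; apply: eq_bigr => j _; rewrite !mxE /GRing.scale/=;
  ring.
Qed.

Lemma is_derive_hline (W : normedModType R) (F : H -> W) p v (s : R) : smooth F
  ->
  is_derive s 1 (fun t : R => F (p + t *: hvec p v)) (hD v F (p + s *: hvec p
    v)).
Proof.
move=> sF; have T := is_derive_line (smooth_differentiable (p + s *: hvec p v)
  sF).
by rewrite hD_derive hvec_line.
Qed.

Lemma dot_delta1 a (j : 'I_n) : dot a (delta_mx 0 j, 0) = a.1 0 j.
Proof.
rewrite dot.unlock (bigD1 j)//= big1 => [|i ij].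
  by rewrite !mxE !eqxx mulr1 mulr0 !addr0.
by rewrite !mxE (negbTE ij) andbF !mulr0 addr0.
Qed.

Lemma dot_delta2 a (j : 'I_n) : dot a (0, delta_mx 0 j) = a.2 0 j.
Proof.
rewrite dot.unlock (bigD1 j)//= big1 => [|i ij].
  by rewrite !mxE !eqxx mulr1 mulr0 add0r addr0.
by rewrite !mxE (negbTE ij) andbF !mulr0 addr0.
Qed.

Lemma bounded_path_compact (T : Type) (P : set T) (c : T -> H) :
  (forall e, exists M : R, forall s, P s -> `|dot (c s).1 e| <= M) ->
  (exists M : R, forall s, P s -> `|(c s).2| <= M) ->
  exists2 K, compact K & forall s, P s -> K (c s).
Proof.
move=> Hz [Mt Ht].
have [M1 H1] := choice (fun j : 'I_n => Hz (delta_mx 0 j, 0)).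
have [M2 H2] := choice (fun j : 'I_n => Hz (0, delta_mx 0 j)).
pose box (M : 'I_n -> R) := [set v : 'rV[R]_n | forall i, [set` `[- M i, M i]]
  (v ord0 i)].
have cbox M : compact (box M).
  by apply: (@rV_compact R n (fun i => [set` `[- M i, M i]])) => i;
    exact: segment_compact.
exists ((box M1 `*` box M2) `*` [set` `[- Mt, Mt]]).
  apply: compact_setX; first exact: compact_setX.
  exact: segment_compact.
move=> s Ps; split; last by rewrite /= in_itv/= -ler_norml; exact: Ht.
split=> j; rewrite /= in_itv/= -ler_norml.
  by rewrite -dot_delta1; exact: H1.
by rewrite -dot_delta2; exact: H2.
Qed.

(** The continuous inverse would carry [K] to a compact set containing an unbounded half-line. *)
Lemma halfline_not_compact (phi g : H -> H) (K : set H) p u :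
  cancel phi g -> continuous g -> compact K -> u != 0 ->
  ~ (forall s : R, 0 <= s -> K (phi (p + s *: u))).
Proof.
move=> phiK cg cK u0 HK.
have : compact (g @` K) by apply: continuous_compact => //;
  exact: continuous_subspaceT.
move=> /compact_bounded[M [_ HM]].
(* Makes the norm of [s *: u] equal to |p| + |M| + 2, so the point has norm at least |M| + 2, above
   the bound |M| + 1. *)
pose s := (`|p| + `|M| + 2) / `|u|.
have s0 : 0 <= s by rewrite divr_ge0// !addr_ge0.
have := HM (`|M| + 1) _ (p + s *: u) _;
  rewrite ltr_pwDr ?ler_norm// => /(_ isT).
have K1 : (g @` K) (p + s *: u).
  by exists (phi (p + s *: u)); [exact: HK|exact: phiK].
move=> /(_ K1); apply/negP; rewrite -ltNge.
have : `|s *: u| <= `|p + s *: u| + `|p|.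
  by rewrite -[X in `|X| <= _](addKr p) addrC (le_trans (ler_normB _ _))// .
rewrite normrZ ger0_norm// /s divfK ?normr_eq0// -/s.
by move: (`|p + s *: u|) (`|p|) => x y; lra.
Qed.
End HorizontalLines.

(** * Rigidity of pseudohermitian transformations *)

Section Pseudohermitian.
Context {R : realType} {n : nat}.
Local Notation E := (hplane R n).
Local Notation H := (heis R n).
Context (phi : H -> H) (hphi : pseudohermitian phi).
Implicit Types (a b c v w : E) (p q u : H).

Local Notation zeta := (fst \o phi).
Local Notation h := (snd \o phi).
Local Notation A v := (hD v zeta).

Lemma fst_continuous (U V : normedModType R) : continuous (fst : U * V -> U).
Proof. by move=> x; exact: cvg_fst. Qed.

Lemma snd_continuous (U V : normedModType R) : continuous (snd : U * V -> V).
Proof. by move=> x; exact: cvg_snd. Qed.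

Lemma smooth_phi : smooth phi.
Proof. by case: hphi => -[]. Qed.

Lemma smooth_zeta : smooth zeta.
Proof.
have T := smooth_linear_comp (@fst_continuous E R^o) smooth_phi; exact: T.
Qed.

Lemma smooth_h : smooth h.
Proof.
have T := smooth_linear_comp (@snd_continuous E R^o) smooth_phi; exact: T.
Qed.

Lemma dphi_hvec p v : 'd phi p (hvec p v) = (A v p, hD v h p).
Proof.
have dp := smooth_differentiable p smooth_phi.
have T1 := derive_linear_comp (@fst_continuous E R^o) (hvec p v) dp.
have T2 := derive_linear_comp (@snd_continuous E R^o) (hvec p v) dp.
rewrite !hD_derive [X in (X, _)]T1 [X in (_, X)]T2 (deriveE _ dp).
by case: ('d phi p (hvec p v)).
Qed.

(** The image is horizontal, and a horizontal vector is determined by its first component. *)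
Lemma dphi_hor p v : 'd phi p (hvec p v) = hvec (phi p) (A v p).
Proof.
case: hphi => _ /(_ p (hvec p v)) [|w _ E1 _]; first by exists v.
by rewrite -E1; congr hvec; rewrite -(hvec1 (phi p) w) E1 dphi_hvec.
Qed.

Lemma contact v p : hD v h p = sig (zeta p) (A v p).
Proof.
by have := dphi_hor p v; rewrite dphi_hvec hvecE => -[].
Qed.

Lemma Jhor_hvec p u : Jhor p u = hvec p (JJ u.1).
Proof. by []. Qed.

Lemma A_J v p : A (JJ v) p = JJ (A v p).
Proof.
have [_ _ HJ] := hphi.
have hv : horizontal p (hvec p v) by exists v.
have := HJ p (hvec p v) hv; rewrite !Jhor_hvec hvec1 !dphi_hor hvec1.
exact: hvec_inj.
Qed.

Lemma dphi_inj p u u' : 'd phi p u = 'd phi p u' -> u = u'.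
Proof.
case: hphi => -[_ [g [sg phiK gK]]] _ _ E1.
have T := diff_comp (smooth_differentiable p smooth_phi) (smooth_differentiable
  (phi p) sg).
have I : g \o phi = id by apply/funext => x; exact: phiK.
have D x : 'd g (phi p) ('d phi p x) = x.
  have := congr1 (fun f => f x) T; rewrite I /= => <-.
  by rewrite diff_val.
have E2 : 'd g (phi p) ('d phi p u) = 'd g (phi p) ('d phi p u') by congr ('d g
  _ _).
exact: (etrans (esym (D u)) (etrans E2 (D u'))).
Qed.

Local Notation l := (lam zeta h).

Lemma dot_A_phi v w p : dot (A v p) (A w p) = dot v w * l p.
Proof. exact: (dot_A smooth_zeta smooth_h A_J contact). Qed.

Lemma A_phi_eq0 v p : A v p = 0 -> v = 0.
Proof.
move=> Av0; apply: (@hvec_inj R n p); apply: (@dphi_inj p).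
by rewrite hvec0 linear0 dphi_hor Av0 hvec0.
Qed.

(** By [dot_A_phi], [lam] times |v|^2 is |A v|^2, which is nonzero since the differential is
    injective. The vector [v] also witnesses that [n] is positive: for [n = 0] the sign of [lam] is
    not determined. *)
Lemma lam_gt0 v p : v != 0 -> 0 < l p.
Proof.
move=> v0; have N0 := dot_gt0 v0; have := dot_ge0 (A v p).
rewrite dot_A_phi pmulr_rge0// le_eqVlt => /predU1P[l0|//].
have : dot (A v p) (A v p) = 0 by rewrite dot_A_phi -l0 mulr0.
by move=> /dot_eq0/A_phi_eq0 vE; rewrite vE eqxx in v0.
Qed.

Lemma smooth_l : smooth l.
Proof. exact: smooth_lam smooth_zeta smooth_h. Qed.

Lemma hvec_neq0 v p : v != 0 -> hvec p v != 0.
Proof. by apply: contra => /eqP/(congr1 fst); rewrite hvec1 => ->. Qed.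

(** A negative derivative at [p] would start a half-line along which [lam] decays like s^(-4), with
    image in a compact set. *)
Lemma hD_lam_ge0 v p : v != 0 -> 0 <= hD v l p.
Proof.
move=> v0; rewrite leNgt; apply/negP => neg.
pose L (s : R) := p + s *: hvec p v.
have d0 (s : R) : is_derive s 1 (fun t => l (L t)) (hD v l (L s)).
  exact: (is_derive_hline p v s smooth_l).
have d1 (s : R) : is_derive s 1 (fun t => hD v l (L t)) (hD v (hD v l) (L s)).
  exact: (is_derive_hline p v s (smooth_hD v smooth_l)).
have L0 : L 0 = p by rewrite /L scale0r addr0.
have [||a [b [a0 b0 decay]]] := quartic_decay d0 d1 (fun s => lam_gt0 (L s) v0).
- move=> s; apply: (hessian_lam_le smooth_zeta smooth_h A_J contact v0).
  by rewrite gt_eqF// (lam_gt0 _ v0).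
- by rewrite L0.
(* The quantity [x] to bound satisfies x^2 <= B; the constant [1 + B] then follows from (x - 1)^2 >=
   0, without a square root. *)
have bd (y y1 : R -> R) B : (forall s : R, is_derive s 1 y (y1 s)) -> 0 <= B ->
    (forall s, 0 <= s -> y1 s ^+ 2 <= B * l (L s)) ->
    exists M, forall s, 0 <= s -> `|y s| <= M.
  move=> dy B0 H1; apply: (@bounded_of_quadratic_decay _ _ y1 (1 + B) a b) =>
    //.
    by rewrite addr_ge0.
  move=> s s0; set x := _ * _; have x2 : x ^+ 2 <= B.
    rewrite /x exprMn real_normK ?num_real// -exprM.
    apply: (@le_trans _ _ (B * l (L s) * (a + b * s) ^+ 4)).
      by rewrite ler_wpM2r ?H1// exprn_even_ge0.
    by rewrite -mulrA ler_piMr// decay.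
  by have := sqr_ge0 (x - 1); nra.
have Hz (e : E) : exists M : R, forall s, 0 <= s -> `|dot (zeta (L s)) e| <= M.
  have dy (s : R) : is_derive s 1 (fun t =>
    dot (zeta (L t)) e) (dot (A v (L s)) e).
    have T := is_derive_hline p v s (smooth_dot_cst e smooth_zeta).
    by apply: (is_derive_eq T); rewrite (hD_dot_cst v e _ smooth_zeta).
  apply: (bd _ _ (dot v v * dot e e) dy); first by rewrite mulr_ge0 ?dot_ge0.
  move=> s s0; apply: le_trans (CauchySchwarz_dot _ _) _.
  by rewrite dot_A_phi mulrAC.
(* The velocity of the t-coordinate is [sig] of [zeta] and [A v], so [zeta] must be bounded
   first. *)
have [B B0 HB] : exists2 B, 0 <= B & forall s, 0 <= s -> dot (zeta (L s)) (zeta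
  (L s)) <= B.
  have [M1 H1] := choice (fun j : 'I_n => Hz (delta_mx 0 j, 0)).
  have [M2 H2] := choice (fun j : 'I_n => Hz (0, delta_mx 0 j)).
  exists (\sum_(j < n) (M1 j ^+ 2 + M2 j ^+ 2)).
    by apply: sumr_ge0 => j _; rewrite addr_ge0 ?sqr_ge0.
  move=> s s0; rewrite dot.unlock; apply: ler_sum => j _.
  have := H1 j s s0; have := H2 j s s0;
    rewrite dot_delta1 dot_delta2 -!expr2 => h2 h1.
  rewrite -[X in X + _]real_normK ?num_real// -[X in _ + X]real_normK
    ?num_real//.
  by rewrite lerD// lerXn2r// nnegrE// ?(le_trans _ h1)// (le_trans _ h2).
have Ht : exists M : R, forall s, 0 <= s -> `|h (L s)| <= M.
  have dy (s : R) : is_derive s 1 (fun t =>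
    h (L t)) (sig (zeta (L s)) (A v (L s))).
    by have T := is_derive_hline p v s smooth_h; rewrite contact in T; exact: T.
  apply: (bd _ _ (B * dot v v) dy); first by rewrite mulr_ge0 ?dot_ge0.
  move=> s s0; rewrite sigE; apply: le_trans (CauchySchwarz_dot _ _) _.
  rewrite dotJJ dot_A_phi mulrA ler_wpM2r//; first exact/ltW/(lam_gt0 _ v0).
  by rewrite ler_wpM2r ?dot_ge0// HB.
have [K cK HK] := @bounded_path_compact R n R (fun s => 0 <= s) (fun s =>
  phi (L s)) Hz Ht.
case: hphi => -[_ [g [sg phiK _]]] _ _.
exact: (halfline_not_compact phiK (smooth_continuous sg) cK (hvec_neq0 p v0)
  HK).
Qed.

(** The inequality [hD_lam_ge0] for [v] and for [- v]. *)
Lemma hD_lam_eq0 v p : hD v l p = 0.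
Proof.
have hDl0 := hD0 p smooth_l.
have [->//|v0] := eqVneq v 0.
have hDN : hD (- v) l p = - hD v l p.
  have T := hD_linear v 0 (- 1) p smooth_l; move: T.
  by rewrite !scaleN1r addr0 hDl0 addr0.
apply/eqP; rewrite eq_le hD_lam_ge0// andbT.
by rewrite -oppr_ge0 -hDN hD_lam_ge0// oppr_eq0.
Qed.

Lemma acc_phi_eq0 v p : v != 0 -> hD v (A v) p = 0.
Proof.
move=> v0; apply: (acc_eq0 smooth_zeta smooth_h A_J contact).
  by rewrite gt_eqF// (lam_gt0 _ v0).
by move=> d; exact: hD_lam_eq0.
Qed.

Lemma A_line v p (s : R) : v != 0 -> A v (p + s *: hvec p v) = A v p.
Proof.
move=> v0; apply: dot_inj => c.
have sA : smooth (A v) by exact: smooth_hD smooth_zeta.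
have dy (t : R) : is_derive t 1 (fun t => dot (A v (p + t *: hvec p v)) c) 0.
  have T := is_derive_hline p v t (smooth_dot_cst c sA).
  apply: (is_derive_eq T); rewrite (hD_dot_cst v c _ sA) acc_phi_eq0//.
  by rewrite -(scale0r 0) dotZl mul0r.
have := is_derive_0_is_cst s 0 dy.
by rewrite scale0r addr0.
Qed.

(** Along the line [A v] is constant, so [zeta] is affine; the speed of [h] is then
    [sig (zeta p) (A v p)] throughout, because [sig] of [A v p] with itself vanishes. *)
Lemma phi_line v p (s : R) :
  phi (p + s *: hvec p v) = phi p + s *: hvec (phi p) (A v p).
Proof.
have [->|v0] := eqVneq v 0.
  by rewrite (hD0 p smooth_zeta) !hvec0 !scaler0 !addr0.
have Ez (t : R) : zeta (p + t *: hvec p v) = zeta p + t *: A v p.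
  apply: dot_inj => c.
  have dy (r : R) : is_derive r 1
      (fun r => dot (zeta (p + r *: hvec p v)) c - dot (A v p) c * r) 0.
    have T := is_derive_hline p v r (smooth_dot_cst c smooth_zeta).
    have T' := is_deriveB T (is_deriveZ (dot (A v p) c) (is_derive_id r 1)).
    apply: (is_derive_eq T'); rewrite (hD_dot_cst v c _ smooth_zeta) A_line//.
    by rewrite [_%:A]mulr1 subrr.
  have := is_derive_0_is_cst t 0 dy.
  rewrite scale0r addr0 mulr0 subr0 dotDl dotZl => /eqP.
  by rewrite subr_eq mulrC => /eqP.
have Eh : h (p + s *: hvec p v) = h p + s * sig (zeta p) (A v p).
  have dy (r : R) : is_derive r 1
      (fun r => h (p + r *: hvec p v) - sig (zeta p) (A v p) * r) 0.
    have T := is_derive_hline p v r smooth_h.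
    have T' := is_deriveB T (is_deriveZ (sig (zeta p) (A v p)) (is_derive_id r
      1)).
    apply: (is_derive_eq T'); rewrite contact Ez A_line//.
    rewrite [_%:A]mulr1 (sigC (_ + _)) sigDr sigZr sig_self mulr0 addr0 (sigC
      (A v p)).
    by rewrite opprK subrr.
  have := is_derive_0_is_cst s 0 dy.
  rewrite scale0r addr0 mulr0 subr0 => /eqP.
  by rewrite subr_eq mulrC => /eqP.
rewrite (hvecE (phi p)); move: (Ez s) Eh => /=.
by case: (phi (p + s *: hvec p v)) => x y /= -> ->.
Qed.

(** The parameter [s] is the same on both sides, so maximal parameters are preserved. *)
Lemma phi_hmul_dilation v p (s : R) :
  phi (hmul p (dilation s (hpoint v))) =
  hmul (phi p) (dilation s (hpoint (A v p))).
Proof. by rewrite !hmul_dilation phi_line. Qed.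

End Pseudohermitian.

(** * Tangent spaces and characteristic points *)

Section TangentImage.
Context {R : realType} {n : nat}.
Local Notation E := (hplane R n).
Local Notation H := (heis R n).
Implicit Types (v w : E) (p q u : H) (S : set H) (f : H -> H).

Lemma heis_basis u : u = hvec 0 u.1 + u.2 *: vert.
Proof.
have s0 : sig (0 : H).1 u.1 = 0 :> R by exact: linear0l.
rewrite hvecE s0; case: u {s0} => x y; congr pair;
  last by rewrite /= add0r [RHS]mulr1.
by rewrite /= scaler0 addr0.
Qed.

Lemma diff_basis f q u :
  'd f q u =
    \sum_(j < n) u.1.1 0 j *: 'd f q (Xfield j 0) +
    \sum_(j < n) u.1.2 0 j *: 'd f q (Yfield j 0) + u.2 *: 'd f q vert.
Proof.
have Z k x : 'd f q (k *: x) = k *: 'd f q x by exact: linearZ.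
rewrite {1}(heis_basis u) linearD Z /hvec linearD !linear_sum.
by rewrite (eq_bigr _ (fun j _ => Z _ _)) [X in _ + X + _](eq_bigr _ (fun j _
  => Z _ _)).
Qed.

(** Smoothness gives continuity of derivatives in fixed directions only; expanding the moving vector
    in a fixed basis gives joint continuity. *)
Lemma diff_continuous2 (T : topologicalType) f (c w : T -> H) (s : T) :
  smooth f -> {for s, continuous c} -> {for s, continuous w} ->
  {for s, continuous (fun t => 'd f (c t) (w t))}.
Proof.
move=> sf cc cw.
have D u : {for s, continuous (fun t => 'd f (c t) u)}.
  have -> : (fun t => 'd f (c t) u) = 'D_u f \o c.
    by apply/funext => t /=; rewrite deriveE//; exact: smooth_differentiable.
  apply: continuous_comp; first exact: cc.
  exact/smooth_continuous/smooth_derive.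
have -> : (fun t => 'd f (c t) (w t)) = (fun t =>
    \sum_(j < n) (w t).1.1 0 j *: 'd f (c t) (Xfield j 0) +
    \sum_(j < n) (w t).1.2 0 j *: 'd f (c t) (Yfield j 0) + (w t).2 *: 'd f (c
      t) vert).
  by apply/funext => t; rewrite diff_basis.
have w1 : {for s, continuous (fun t => (w t).1)}.
  by have Tc := continuous_comp cw (@fst_continuous R E R^o (w s)); exact: Tc.
apply: cvgD; first apply: cvgD.
- apply: cvg_big => [|j _]; first exact: add_continuous.
  apply: cvgZ; last exact: D.
  by have Tc := continuous_comp w1 (@coord1_continuous R n j (w s).1);
    exact: Tc.
- apply: cvg_big => [|j _]; first exact: add_continuous.
  apply: cvgZ; last exact: D.
  by have Tc := continuous_comp w1 (@coord2_continuous R n j (w s).1);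
    exact: Tc.
- apply: cvgZ; last exact: D.
  by have Tc := continuous_comp cw (@snd_continuous R E R^o (w s)); exact: Tc.
Qed.

Lemma tangent_image f S p u : smooth f ->
  tangent S p u -> tangent (f @` S) (f p) ('d f p u).
Proof.
move=> sf [e [c [e0 [dc Dc] Sc c0 D0]]].
have df q : differentiable f q by exact: smooth_differentiable.
have Dfc (r s : R^o) : ball (0 : R^o) e s ->
    'D_r (f \o c) s = 'd f (c s) ('D_r c s).
  move=> bs; rewrite !deriveE; [|exact: dc|exact/differentiable_comp/df/dc].
  by have T := congr1 (fun k => k r) (diff_comp (dc s bs) (df (c s))); exact: T.
have b0 : ball (0 : R^o) e 0 by exact: ballxx.
exists e, (f \o c); split; first exact: e0.
- split=> [s bs|r s bs]; first exact/differentiable_comp/df/dc.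
  have K := @diff_continuous2 _ f c ('D_r c) s sf
    (differentiable_continuous (dc s bs)) (Dc r s bs).
  (* The chain rule is available only inside the ball, so continuity passes through a neighbourhood
     of [s]. *)
  have E1 : {near s, (fun t => 'd f (c t) ('D_r c t)) =1 'D_r (f \o c)}.
    have : nbhs s (ball (0 : R^o) e) by apply: open_nbhs_nbhs; split=> //;
      exact: ball_open.
    by apply: filterS => t bt; rewrite Dfc.
  rewrite /prop_for /continuous_at (Dfc _ _ bs).
  exact: cvg_trans (near_eq_cvg E1) K.
- by move=> s bs; exists (c s) => //; exact: Sc.
- by rewrite /= c0.
- by rewrite (Dfc _ _ b0) c0 D0.
Qed.

End TangentImage.

(** * Transport of tangency, characteristic points and segments *)

Section PseudohermitianImage.
Context {R : realType} {n : nat}.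
Local Notation E := (hplane R n).
Local Notation H := (heis R n).
Context (phi : H -> H) (hphi : pseudohermitian phi).
Implicit Types (v w : E) (p q u : H) (S : set H).

Local Notation A v := (hD v (fst \o phi)).

Lemma phi_inj : injective phi.
Proof. by case: hphi => -[_ [g [_ phiK _]]] _ _; exact: can_inj phiK. Qed.

Lemma horizontal_image p w : exists v, hvec (phi p) w = 'd phi p (hvec p v).
Proof.
(* Nonvanishing of [lam] is obtained from a nonzero vector, hence the separate case. *)
have [->|w0] := eqVneq w 0.
  by exists 0; rewrite !hvec0 linear0.
have l0 : lam (fst \o phi) (snd \o phi) p != 0.
  by rewrite gt_eqF// (lam_gt0 hphi _ w0).
have [v ->] := A_surj (smooth_zeta hphi) (smooth_h hphi) (A_J hphi) (contact
  hphi) w l0.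
by exists v; rewrite (dphi_hor hphi).
Qed.

(** Apply [tangent_image] to the smooth inverse. *)
Lemma tangent_imageP S p u :
  tangent (phi @` S) (phi p) u -> exists2 u0, tangent S p u0 & u = 'd phi p u0.
Proof.
case: (hphi) => -[sphi [g [sg phiK gK]]] _ _ tu.
exists ('d g (phi p) u).
  have := tangent_image sg tu; rewrite phiK.
  have -> // : g @` (phi @` S) = S.
  apply/seteqP; split=> [_ [_ [x Sx <-] <-]|x Sx]; first by rewrite phiK.
  by exists (phi x); rewrite ?phiK//; exists x.
have dphi := smooth_differentiable (g (phi p)) sphi.
have T := diff_comp (smooth_differentiable (phi p) sg) dphi.
have I : phi \o g = id by apply/funext => x; exact: gK.
have := congr1 (fun f => f u) T; rewrite I phiK /= => <-.
by rewrite diff_val.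
Qed.

(** The differential maps horizontal and tangent spaces bijectively onto those of the image, so
    their equality passes both ways. *)
Lemma char_set_image S p : S p -> char_set (phi @` S) (phi p) <-> char_set S p.
Proof.
move=> Sp; split=> -[_ HT].
  split=> //; apply/seteqP; split=> [_ [v _ <-]|u tu].
    have : horizontal (phi p) ('d phi p (hvec p v)).
      by rewrite (dphi_hor hphi); exists (A v p).
    by rewrite HT => /tangent_imageP[u0 tu0 /(dphi_inj hphi)->].
  have : tangent (phi @` S) (phi p) ('d phi p u).
    exact: (tangent_image (smooth_phi hphi)).
  rewrite -HT => -[w _]; have [v ->] := horizontal_image p w.
  by move=> /(dphi_inj hphi) <-; exists v.
split; first by exists p.
apply/seteqP; split=> [_ [w _ <-]|u /tangent_imageP[u0 tu0 ->]].
  have [v ->] := horizontal_image p w; apply: (tangent_image (smooth_phi hphi)).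
  by rewrite -HT; exists v.
move: tu0; rewrite -HT => -[v _ <-]; rewrite (dphi_hor hphi).
by exists (A v p).
Qed.

Lemma image_phi S p : (phi @` S) (phi p) <-> S p.
Proof.
by split=> [[q Sq /phi_inj <-]|Sp]; [|exists p].
Qed.

Lemma segment_in_image S p v s :
  segment_in (phi @` S) (phi p) (A v p) s <-> segment_in S p v s.
Proof.
split=> seg t ts.
  by have := seg t ts; rewrite -(phi_hmul_dilation hphi) image_phi.
by rewrite -(phi_hmul_dilation hphi) image_phi; exact: seg.
Qed.

End PseudohermitianImage.

Theorem theorem3p10 (R : realType) (n : nat) (S : set (heis R n))
    (hS : C1_hypersurface S) (hruled : ruled S)
    (phi : heis R n -> heis R n) (hphi : pseudohermitian phi) :
  ruled (phi @` S).
Proof.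
move=> _ [[p Sp <-] nchar] w [_ tw] s s0 seg smax.
(* Pull [w] back to a horizontal vector with coefficients [v]; by injectivity of the differential it
   is also the tangent preimage [u0], so [v] is an admissible direction for [S] at [p]. *)
have [v wE] := horizontal_image hphi p w.
have [u0 tu0] := tangent_imageP hphi tw.
rewrite wE => /(dphi_inj hphi) u0E; subst u0.
move: wE; rewrite (dphi_hor hphi) => /hvec_inj wE; subst w.
rewrite -(phi_hmul_dilation hphi); apply/(char_set_image hphi).
  by move: (seg) => /(segment_in_image hphi)/(_ s); apply; rewrite s0 lexx.
apply: hruled => //.
- by split=> // /(char_set_image hphi Sp).
- by split=> //; exists v.
- exact/(segment_in_image hphi).
- by move=> s' s'0 /(segment_in_image hphi); exact: smax.
Qed.
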